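(* Let $\alpha$ be a probability measure on $E=\{-1,0,1\}$ with $\alpha(a)>0$ for all $a\in E$, and consider the hard-core Widom-Rowlinson model on $\mathbb Z^d$. (a) (Asymmetric model.) Let $\alpha(-1)<\alpha(1)$ and assume the model is in the low-intensity regime (with starting measure $\mu^+$). Then the time-evolved measure $\mu^+_t$ is non-Gibbs for all $0<t<t_G:=\frac12\log\big(\frac{\alpha(1)+\alpha(-1)}{\alpha(1)-\alpha(-1)}\big)$. (b) (Symmetric model.) Let $\alpha(-1)=\alpha(1)$ and assume the model is in the low-intensity regime. Then, for any translation-invariant Gibbs measure $\mu\in\mathcal G(\gamma^{hc}_\alpha)$ as starting measure, the time-evolved measure $\mu_t$ is non-Gibbs for all $t>0$. In both cases the sets of bad configurations have zero measure with respect to the time-evolved measure, i.e. there is a specification admitting the time-evolved measure whose set of bad configurations has probability zero under the time-evolved measure.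
   Context: Let $\Omega=E^{\mathbb Z^d}$ with product $\sigma$-algebra $\mathcal F$; for $\Lambda\subset\mathbb Z^d$ let $\mathcal F_\Lambda$ be the $\sigma$-algebra generated by the coordinates in $\Lambda$, and $\Lambda^c=\mathbb Z^d\setminus\Lambda$. Write $i\sim j$ if $\|i-j\|_1=1$, and for finite $\Lambda$ let $\mathcal E^b_\Lambda=\{\{i,j\}: i\sim j,\ \{i,j\}\cap\Lambda\ne\emptyset\}$. A function is local if it is $\mathcal F_\Lambda$-measurable for some finite $\Lambda$, and quasilocal if it is a uniform limit of local functions. A specification $\gamma=(\gamma_\Lambda)$, indexed by finite $\Lambda$, is a family of probability kernels from $\mathcal F_{\Lambda^c}$ to $\mathcal F$ with $\gamma_\Lambda(B|\cdot)=\mathbf 1_B$ for $B\in\mathcal F_{\Lambda^c}$ and $\gamma_\Lambda(\gamma_\Delta(A|\cdot)|\omega)=\gamma_\Lambda(A|\omega)$ for $\Delta\subset\Lambda$, $A\in\mathcal F$; it is quasilocal if $\gamma_\Lambda(f|\cdot)$ is quasilocal for each finite $\Lambda$ and quasilocal $f$. A probability measure $\mu$ is admitted by $\gamma$ if $\mu(A|\mathcal F_{\Lambda^c})=\gamma_\Lambda(A|\cdot)$ $\mu$-a.s. for all finite $\Lambda$, $A\in\mathcal F$; $\mathcal G(\gamma)$ is the set of such measures when $\gamma$ is quasilocal. A probability measure is Gibbs if it is admitted by some quasilocal specification, and non-Gibbs if every specification admitting it fails to be quasilocal. A configuration $\eta\in\Omega$ is bad for a specification $\gamma$ if there exist a finite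 $\Delta\subset\mathbb Z^d$, a local function $f$ and $\zeta^1,\zeta^2\in\Omega$ with $\lim_{\Lambda\uparrow\mathbb Z^d}|\gamma_\Delta(f|\eta_{\Lambda\setminus\Delta}\zeta^1_{\Lambda^c})-\gamma_\Delta(f|\eta_{\Lambda\setminus\Delta}\zeta^2_{\Lambda^c})|>0$. The hard-core specification is $\gamma^{hc}_{\Lambda,\alpha}(\omega|\eta)=\frac1{Z_\eta}\prod_{\{i,j\}\in\mathcal E^b_\Lambda}\mathbf 1(\xi_i\xi_j\ne-1)\prod_{i\in\Lambda}\alpha(\omega_i)$ with $\xi=\omega_\Lambda\eta_{\Lambda^c}$; $\mu^+=\lim_{\Lambda\uparrow\mathbb Z^d}\gamma^{hc}_{\Lambda,\alpha}(\cdot|\omega^+)$ with $\omega^+_i=1$ for all $i$. Clusters of a configuration $\omega$ are the maximal nearest-neighbor connected components of the occupied set $\{i:\omega_i\neq0\}$. The model is in the high-intensity regime if for some finite $\Lambda\subset\mathbb Z^d$ the event that there is an infinite cluster $C$ with $C\cap\Lambda\neq\emptyset$ has positive probability under the starting measure; otherwise it is in the low-intensity regime (no infinite cluster almost surely). Time evolution: for $a,b\in E$, $t>0$, $$p_t(a,b)=\tfrac12(1+e^{-2t})\mathbf 1_{a=b\ne0}+\tfrac12(1-e^{-2t})\mathbf 1_{ab=-1}+\mathbf 1_{a=b=0},$$ $p_t(\omega,d\eta)=\prod_{i}p_t(\omega_i,d\eta_i)$, and $\mu_t(f)=\int\int f(\eta)\,p_t(\omega,d\eta)\,\mu(d\omega)$.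 *)

(* Defs.v *)
From HB Require Import structures.
From mathcomp Require Import all_boot all_order all_algebra finmap.
From mathcomp Require Import all_classical all_reals all_analysis.
From mathcomp Require Import measurable_realfun.
From mathcomp Require summability.

Set Implicit Arguments.
Unset Strict Implicit.
Unset Printing Implicit Defensive.

Import Order.TTheory GRing.Theory Num.Theory.
Import numFieldNormedType.Exports.

Local Open Scope classical_set_scope.
Local Open Scope ring_scope.

Notation totally := summability.totally.
#[global] Existing Instance summability.totally_filter.

Definition spin : Type := seq_sub [:: -1; 0; 1 : int].

Definition spin_m1 : spin := @SeqSub _ [:: -1; 0; 1 : int] (-1) isT.
Definition spin_0 : spin := @SeqSub _ [:: -1; 0; 1 : int] 0 isT.
Definition spin_p1 : spin := @SeqSub _ [:: -1; 0; 1 : int] 1 isT.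

HB.instance Definition _ := Finite.on spin.
HB.instance Definition _ := isPointed.Build spin spin_0.
HB.instance Definition _ := @isMeasurable.Build default_measure_display spin
  discrete_measurable discrete_measurable0
  discrete_measurableC discrete_measurableU.

Definition spin_val (a : spin) : int := ssval a.

Definition site (d : nat) : Type := 'rV[int]_d.

HB.instance Definition _ d := GRing.Zmodule.on (site d).
HB.instance Definition _ d := Countable.on (site d).

Definition nn (d : nat) (i j : site d) : bool :=
  \sum_(k < d) `|i ord0 k - j ord0 k| == 1.

Definition coordinate_events (d : nat) (S : set (site d)) :
    set_system (site d -> spin) :=
  \bigcup_(i in S)
    preimage_set_system setT (fun w : site d -> spin => w i) measurable.

(* The configuration space carrying the sub-sigma-algebra F_S. *)
Notation config_on S := (g_sigma_algebraType (coordinate_events S)).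
Notation config d := (config_on [set: site d]).

(* [splice L w eta] is w on L and eta off L. *)
Definition splice (d : nat) (L : {fset site d}) (w eta : config d) : config d :=
  fun i => if i \in L then w i else eta i.

Section specifications.
Variables (R : realType) (d : nat).

Definition measurable_on (S : set (site d)) (dT : measure_display)
    (T : measurableType dT) (f : config d -> T) : Prop :=
  measurable_fun [set: config_on S] f.

Definition local (f : config d -> R) : Prop :=
  exists L : {fset site d}, measurable_on [set` L] f.

Definition quasilocal (f : config d -> R) : Prop :=
  exists2 g : (config d -> R)^nat,
    (forall n, local (g n)) & {uniform, g @ \oo --> f}.

Definition kernel_family := {fset site d} -> config d -> probability (config d) R.

Record is_specification (gamma : kernel_family) : Prop := {
  spec_measurable : forall (L : {fset site d}) (A : set (config d)),
    measurable A -> measurable_on (~` [set` L]) (fun w => gamma L w A);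
  spec_proper : forall (L : {fset site d}) (B : set (config_on (~` [set` L]))),
    measurable B -> forall w, gamma L w B = (\1_B w)%:E;
  spec_consistent : forall D L : {fset site d}, (D `<=` L)%fset ->
    forall A : set (config d), measurable A ->
    forall w, (\int[gamma L w]_x gamma D x A)%E = gamma L w A }.

Definition quasilocal_specification (gamma : kernel_family) : Prop :=
  forall (L : {fset site d}) (f : config d -> R),
    quasilocal f -> quasilocal (fun w => \int[gamma L w]_x f x).

(* g is a version of the conditional probability mu(A | F_S). *)
Definition cond_prob_version (mu : probability (config d) R)
    (S : set (site d)) (A : set (config d)) (g : config d -> \bar R) : Prop :=
  measurable_on S g /\
  forall B : set (config_on S), measurable B ->
    (\int[mu]_(x in B) g x)%E = mu (A `&` B).

Definition admitted (gamma : kernel_family) (mu : probability (config d) R) :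
    Prop :=
  forall (L : {fset site d}) (A : set (config d)), measurable A ->
    cond_prob_version mu (~` [set` L]) A (fun w => gamma L w A).

Definition Gibbs_measures (gamma : kernel_family) :
    set (probability (config d) R) :=
  [set mu | admitted gamma mu].

Definition Gibbs (mu : probability (config d) R) : Prop :=
  exists gamma : kernel_family,
    [/\ is_specification gamma, quasilocal_specification gamma
      & admitted gamma mu].

Definition non_Gibbs (mu : probability (config d) R) : Prop :=
  forall gamma : kernel_family, is_specification gamma -> admitted gamma mu ->
    ~ quasilocal_specification gamma.

(* gamma_D only sees the boundary condition off D, so the value of
   [splice L eta z] on D is irrelevant. *)
Definition bad (gamma : kernel_family) : set (config d) :=
  [set eta | exists (D : {fset site d}) (f : config d -> R)
      (z1 z2 : config d), local f /\
    exists2 l : R, 0 < l &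
      `| \int[gamma D (splice L eta z1)]_x f x
         - \int[gamma D (splice L eta z2)]_x f x | @[L --> totally] --> l].

Definition translation_invariant (mu : probability (config d) R) : Prop :=
  forall (z : site d) (A : set (config d)), measurable A ->
    mu [set w | A (fun i => w (i + z))] = mu A.

End specifications.

Section hard_core.
Variables (R : realType) (d : nat) (alpha : probability spin R).

Definition mass (a : spin) : R := fine (alpha [set a]).

(* the edges meeting L, as two-element sets of sites *)
Definition edges (L : {fset site d}) : set {fset site d} :=
  [set e | exists i j, [/\ nn i j, e = [fset i; j]%fset
                         & (e `&` L)%fset != fset0]].

(* Needed for the product over [edges L] below to be the genuine one: a
   [\big_(e \in A)] with infinite support is the neutral element. *)
Lemma finite_edges (L : {fset site d}) : finite_set (edges L).
Proof.
pose h (u : site d * {ffun 'I_d -> spin}) : {fset site d} :=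
  [fset u.1; (u.1 + \row_k spin_val (u.2 k))%R]%fset.
apply: (@sub_finite_set _ _ (h @` ([set` L] `*` setT))); last first.
  by apply: finite_image; apply: finite_setX => //; exact: finite_fset.
have key (i j : site d) : i \in L -> nn i j ->
    (h @` ([set` L] `*` setT)) [fset i; j]%fset.
  move=> iL /eqP ij.
  have le1 k : j ord0 k - i ord0 k \in [:: -1; 0; 1 : int].
    have : `|i ord0 k - j ord0 k| <= 1.
      rewrite -[leRHS]ij (bigD1 k)//= lerDl.
      by apply: sumr_ge0 => l _; exact: normr_ge0.
    rewrite distrC; case: (_ - _) => [[|[|n]]|[|n]] //.
  exists (i, [ffun k => SeqSub (le1 k)]) => //.
  rewrite /h /=; congr [fset _; _]%fset; apply/rowP => k.
  by rewrite !mxE ffunE /spin_val /= addrC subrK.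
move=> _ [i [j [ij -> /fset0Pn[k]]]]; rewrite !inE => /andP[/orP[]/eqP-> kL].
  exact: key.
by rewrite fsetUC; apply: key => //; rewrite /nn; under eq_bigr do rewrite distrC.
Qed.

Definition extend (L : {fset site d}) (s : {ffun L -> spin}) (eta : config d) :
    config d :=
  fun i => if insub i is Some j then s j else eta i.

Definition hc_weight (L : {fset site d}) (eta : config d)
    (s : {ffun L -> spin}) : R :=
  let xi := extend s eta in
  (\big[*%R/1]_(e \in edges L)
     ((\prod_(i <- e) spin_val (xi i) != -1)%:R : R))
  * \prod_(i : L) mass (s i).

Lemma mass_ge0 a : 0 <= mass a.
Proof. exact: fine_ge0. Qed.

Lemma hc_weight_ge0 L eta s : 0 <= @hc_weight L eta s.
Proof.
apply: mulr_ge0; first by elim/big_ind: _ => // x y; exact: mulr_ge0.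
by apply: prodr_ge0 => i _; exact: mass_ge0.
Qed.

Definition hc_unnormalized (L : {fset site d}) (eta : config d)
    (A : set (config d)) : \bar R :=
  (\sum_(s : {ffun L -> spin}) (hc_weight eta s)%:E * \d_(extend s eta) A)%E.

Section measure.
Variables (L : {fset site d}) (eta : config d).
Local Open Scope ereal_scope.

Let m (n : nat) : {measure set (config d) -> \bar R} :=
  if insub n is Some k then
    let s := enum_val (k : 'I_#|{: {ffun L -> spin}}|) in
    mscale (NngNum (hc_weight_ge0 eta s)) \d_(extend s eta)
  else mzero.

Let hc_unnormalizedE :
  hc_unnormalized L eta = msum m #|{: {ffun L -> spin}}|.
Proof.
apply/funext => A; rewrite /hc_unnormalized /msum (reindex_onto enum_val enum_rank);
  last by move=> s _; rewrite enum_rankK.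
apply: eq_big => [k|k _]; first by rewrite enum_valK eqxx.
by rewrite /m valK.
Qed.

Let hc0 : hc_unnormalized L eta set0 = 0.
Proof. by rewrite hc_unnormalizedE measure0. Qed.

Let hc_ge0 A : 0 <= hc_unnormalized L eta A.
Proof. by rewrite hc_unnormalizedE. Qed.

Let hc_sigma_additive : semi_sigma_additive (hc_unnormalized L eta).
Proof. rewrite hc_unnormalizedE; exact: measure_semi_sigma_additive. Qed.

HB.instance Definition _ :=
  isMeasure.Build _ _ _ (hc_unnormalized L eta) hc0 hc_ge0 hc_sigma_additive.

End measure.

(* [mnormalize] divides by the total mass Z_eta; its second argument is the
   fallback for total mass 0, which never occurs when alpha gives mass to 0. *)
Definition hc_specification : kernel_family R d :=
  fun L eta => mnormalize (hc_unnormalized L eta) \d_eta.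

Definition plus_config : config d := fun=> spin_p1.

(* mu is the limit of the finite-volume measures with plus boundary condition,
   along the net of finite volumes and tested against local functions. *)
Definition is_plus_measure (mu : probability (config d) R) : Prop :=
  forall f : config d -> R, local f ->
    \int[hc_specification L plus_config]_x f x @[L --> totally]
      --> (\int[mu]_x f x : R).

Definition t_G : R :=
  2^-1 * ln ((mass spin_p1 + mass spin_m1) / (mass spin_p1 - mass spin_m1)).

End hard_core.

Section clusters.
Variables (R : realType) (d : nat).

Definition occupied (w : config d) : set (site d) := [set i | w i != spin_0].

Definition nn_connected (C : set (site d)) : Prop :=
  forall i j, C i -> C j ->
    exists p : seq (site d),
      [/\ path (@nn d) i p, last i p = j & [set` p] `<=` C].

Definition is_cluster (w : config d) (C : set (site d)) : Prop :=
  [/\ C !=set0, C `<=` occupied w, nn_connected C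
    & forall C', C `<=` C' -> C' `<=` occupied w -> nn_connected C' -> C' = C].

Definition high_intensity (mu : probability (config d) R) : Prop :=
  exists L : {fset site d},
    (0 < mu [set w | exists C, [/\ is_cluster w C, infinite_set C
                                 & C `&` [set` L] !=set0]])%E.

Definition low_intensity (mu : probability (config d) R) : Prop :=
  ~ high_intensity mu.

End clusters.

Section time_evolution.
Variables (R : realType) (d : nat).

Definition flip (t : R) (a b : spin) : R :=
  2^-1 * (1 + expR (- (2 * t))) * ((a == b) && (a != spin_0))%:R
  + 2^-1 * (1 - expR (- (2 * t))) * (spin_val a * spin_val b == -1)%:R
  + ((a == b) && (a == spin_0))%:R.

(* For each starting configuration w, P w is the product over all sites i of
   the laws flip t (w i), which is pinned down by its values on cylinders. *)
Definition is_flip_kernel (t : R) (P : R.-pker (config d) ~> (config d)) : Prop :=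
  forall (w a : config d) (L : {fset site d}),
    P w [set eta | forall i, i \in L -> eta i = a i]
    = (\prod_(i <- L) flip t (w i) (a i))%:E.

Definition is_time_evolution (t : R) (mu mut : probability (config d) R) : Prop :=
  exists2 P : R.-pker (config d) ~> (config d), is_flip_kernel t P &
    forall f : config d -> \bar R, measurable_fun setT f ->
      (forall w, 0 <= f w)%E ->
      (\int[mut]_eta f eta = \int[mu]_w \int[P w]_eta f eta)%E.

End time_evolution.

(* Main.v *)
Require Import Defs.
From HB Require Import structures.
From mathcomp Require Import all_boot all_order all_algebra finmap.
From mathcomp Require Import all_classical all_reals all_analysis.
From mathcomp Require Import measurable_realfun.
From mathcomp Require Import ring lra.

Set Implicit Arguments.
Unset Strict Implicit.
Unset Printing Implicit Defensive.

Import Order.TTheory GRing.Theory Num.Theory.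
Import numFieldNormedType.Exports.

Local Open Scope classical_set_scope.
Local Open Scope ring_scope.

(** The evolution never creates or removes a particle, and the hard-core
condition forces every occupied cluster of the starting configuration to carry
a single sign.  A particle system at time [t] is thus a set of occupied sites
together with, for each finite cluster, a hidden sign observed through
independent noise at each site of the cluster.  Everything below follows from
this picture, with clusters handled through the sets that enclose them: a
finite set [D] is sealed in [xi] when all sites outside [D] next to [D] are
empty.

The starting measures enter through a clearing rule: the probability of a
cylinder that prescribes the neighbourhood of a block [K] is the Boltzmann
weight of [K] times the probability of the cylinder with [K] emptied.  It is
immediate in finite volume
([hc_unnormalized_cylinder]) and survives both the DLR equation
([Gibbs_clearing_rule]) and the limit with plus boundary condition
([plus_clearing_rule]).  Summing it over the configurations at time 0 gives
the same rule at time [t] for sealed blocks, with the hidden configuration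
summed out: [prob_evolved_factor], through [noisy_sum_factor].

Specification.  The ratio [odds D L xi] of the summed weight of a sealed set
[D] before and after emptying [L] is unchanged when [D] grows
([odds_enlarge]), so it defines a relative weight [tilt L xi] of the contents
of [L].  If no finite sealed set contains the particles of [L] the weight is
0: the specification forbids infinite clusters from meeting [L].  The cocycle
identity [tilt_cocycle] makes the normalized weights a specification for every
boundary condition, infinite clusters elsewhere included.  It admits the
evolved measure because the two agree on the configurations in which [L] is
enclosed within a large box ([resample_local]), and in the low-intensity
regime these exhaust almost everything.  When all clusters of [eta] are
finite, the kernels at [eta] do not see anything beyond a finite enclosing
set; hence bad configurations have an infinite cluster ([bad_not_surrounded]).

Non-Gibbsianness.  Occupy a long segment issuing from the origin and empty its
surroundings.  The law of the spin at the origin depends on the posterior of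
the common hidden sign.  A far end observed as plus makes the hidden plus more
likely by a factor [activity 1 * p_keep / (activity (-1) * p_flip)] per site;
observed as minus it makes the hidden minus more likely by
[activity (-1) * p_keep / (activity 1 * p_flip)] per site, which exceeds 1
exactly before [t_G], and always in the symmetric case.  So two finite
patterns that agree on any given finite set pull the conditional probability
to two sides of a fixed gap.  Since both patterns have positive probability,
no version of the conditional probability is quasilocal
([non_Gibbs_of_discrepancy]). *)

(** * Configurations, sealed sets and sums over a block *)

Section configurations.
Variable d : nat.
Implicit Types (K L M D : {fset site d}) (x y xi eta omega : config d).

Lemma nn_sym : symmetric (@nn d).
Proof. by move=> i j; rewrite /nn; under eq_bigr do rewrite distrC. Qed.

Lemma nn_neq (i j : site d) : nn i j -> i != j.
Proof.
by apply: contraTneq => ->; rewrite /nn big1// => k _; rewrite subrr normr0.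
Qed.

Definition vacuum : config d := fun=> spin_0.

Definition clear L xi : config d := splice L vacuum xi.

Definition cylinder M x : set (config d) :=
  [set eta | forall i, i \in M -> eta i = x i].

Definition nbhd_in K M : Prop :=
  (K `<=` M)%fset /\ forall i j, i \in K -> nn i j -> j \in M.

(** No particle sits next to [D] outside [D], so every cluster meeting [D]
stays inside. *)
Definition sealed D xi : Prop :=
  forall i j, i \in D -> nn i j -> j \notin D -> xi j = spin_0.

Lemma clearE L xi i : clear L xi i = if i \in L then spin_0 else xi i.
Proof. by []. Qed.

Lemma clear_vacuum L : clear L vacuum = vacuum.
Proof. by apply/funext => i; rewrite clearE; case: ifP. Qed.

Lemma clear_clear K L xi : (K `<=` L)%fset -> clear L (clear K xi) = clear L xi.
Proof.
move=> KL; apply/funext => i; rewrite !clearE; case: ifPn => // iL.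
by case: ifPn => // iK; rewrite (fsubsetP KL _ iK) in iL.
Qed.

Lemma clear_eq L xi : (forall i, i \in L -> xi i = spin_0) -> clear L xi = xi.
Proof. by move=> h; apply/funext => i; rewrite clearE; case: ifPn => // /h. Qed.

Lemma eq_clear L xi eta : (forall i, i \notin L -> xi i = eta i) ->
  clear L xi = clear L eta.
Proof. by move=> h; apply/funext => i; rewrite !clearE;
  case: ifPn => // /h. Qed.

Lemma sealed_clear L D xi : sealed D xi -> sealed D (clear L xi).
Proof. by move=> h i j iD ij jD; rewrite clearE (h i j)// if_same. Qed.

Lemma eq_sealed D xi eta : (forall i j, i \in D -> nn i j -> j \notin D ->
  xi j = eta j) -> sealed D xi -> sealed D eta.
Proof. by move=> e h i j iD ij jD; rewrite -(e i j)//; exact: (h i j). Qed.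

Lemma sealedU D1 D2 xi : sealed D1 xi -> sealed D2 xi ->
  sealed (D1 `|` D2)%fset xi.
Proof.
move=> s1 s2 i j; rewrite !inE negb_or => /orP[] iD ij /andP[j1 j2].
- exact: (s1 i j).
- exact: (s2 i j).
Qed.

Lemma nbhd_inS K M M' : nbhd_in K M -> (M `<=` M')%fset -> nbhd_in K M'.
Proof.
move=> [KM nM] MM'; split; first exact: fsubset_trans MM'.
by move=> i j iK ij; apply: (fsubsetP MM'); exact: (nM i).
Qed.

Lemma nbhd_exists K : exists M, nbhd_in K M.
Proof.
have fin : finite_set (\bigcup_(e in edges K) [set` e]).
  by apply: bigcup_finite => [|e _]; [exact: finite_edges|exact: finite_fset].
exists (K `|` fset_set (\bigcup_(e in edges K) [set` e]))%fset.
split; first exact: fsubsetUl.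
move=> i j iK ij; rewrite in_fsetU; apply/orP; right.
rewrite in_fset_set//; apply/mem_set; exists [fset i; j]%fset => /=.
- exists i, j; split => //; apply/fset0Pn; exists i.
  by rewrite !inE eqxx iK.
- by rewrite !inE eqxx orbT.
Qed.

Section extend.
Variable L : {fset site d}.

Lemma extend_notin (s : {ffun L -> spin}) xi i :
  i \notin L -> extend s xi i = xi i.
Proof. by move=> iL; rewrite /extend insubN. Qed.

Lemma extend_val (s : {ffun L -> spin}) xi (j : L) : extend s xi (val j) = s j.
Proof. by rewrite /extend valK. Qed.

Lemma extend_in (s : {ffun L -> spin}) xi eta i :
  i \in L -> extend s xi i = extend s eta i.
Proof. by move=> iL; rewrite /extend insubT. Qed.

Definition restrict xi : {ffun L -> spin} := [ffun j => xi (val j)].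

Lemma extend_restrict x xi : extend (restrict x) xi = splice L x xi.
Proof.
apply/funext => i; rewrite /splice; case: ifPn => iL; last exact: extend_notin.
by rewrite -[i]/(val [` iL]%fset) extend_val ffunE.
Qed.

End extend.

Section block_sum.
Variable V : nmodType.
Implicit Types f g : config d -> V.

Definition block_sum L f xi : V := \sum_(s : {ffun L -> spin}) f (extend s xi).

Lemma eq_block_sum L f g xi :
  (forall eta, (forall i, i \notin L -> eta i = xi i) -> f eta = g eta) ->
  block_sum L f xi = block_sum L g xi.
Proof.
by move=> fg; apply: eq_bigr => s _; apply: fg => i iL; rewrite extend_notin.
Qed.

Lemma eq_block_sum_off L f xi eta :
  (forall i, i \notin L -> eta i = xi i) ->
    block_sum L f eta = block_sum L f xi.
Proof.
move=> h; apply: eq_bigr => s _; congr f; apply/funext => i.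
have [iL|iL] := boolP (i \in L); first exact: extend_in.
by rewrite !extend_notin// h.
Qed.

Lemma block_sum_split K L f xi : (K `<=` L)%fset ->
  block_sum L f xi = block_sum (L `\` K)%fset (block_sum K f) xi.
Proof.
move=> KL; rewrite /block_sum pair_big /=.
rewrite (reindex (fun s : {ffun L -> spin} =>
  (restrict (L `\` K)%fset (extend s xi), restrict K (extend s xi)))) /=.
  apply: eq_bigr => s _; congr f; apply/funext => i.
  rewrite !extend_restrict /splice !inE.
  case: ifPn => // iK; rewrite iK /=.
  by case: ifPn => // iL; rewrite extend_notin.
exists (fun p => restrict L (extend p.2 (extend p.1 xi))) => [s _|[v u] _] /=.
  rewrite !extend_restrict; apply/ffunP => j; rewrite ffunE /splice !inE.
  by rewrite (valP j) andbT !extend_val; case: ifPn => // ->.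
rewrite !extend_restrict; congr pair; apply/ffunP => j; rewrite ffunE /splice.
- have := valP j; rewrite !inE => /andP[jK ->].
  by rewrite extend_notin// extend_val.
- by rewrite (fsubsetP KL _ (valP j)) extend_val.
Qed.

Lemma block_sum_point K f x xi :
  (forall eta, (forall i, i \notin K -> eta i = xi i) ->
    ~ cylinder K x eta -> f eta = 0) ->
  block_sum K f xi = f (splice K x xi).
Proof.
move=> f0; rewrite /block_sum (bigD1 (restrict K x))//= extend_restrict.
rewrite big1 ?addr0// => s sx; apply: f0 => [i iK|sxK].
  by rewrite extend_notin.
move/eqP: sx; apply; apply/ffunP => j.
by rewrite ffunE -sxK ?(valP j)// extend_val.
Qed.

End block_sum.

Lemma block_sumMl (R : pzRingType) L (g f : config d -> R) xi :
  (forall eta, (forall i, i \notin L -> eta i = xi i) -> g eta = g xi) ->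
  block_sum L (fun eta => g eta * f eta) xi = g xi * block_sum L f xi.
Proof.
move=> gL; rewrite /block_sum mulr_sumr; apply: eq_bigr => s _.
by rewrite (gL (extend s xi))// => i iL; rewrite extend_notin.
Qed.

End configurations.
Arguments vacuum {d}.

(** * Spin flips and hard-core weights *)

Section flip.
Variables (R : realType) (t : R).
Hypothesis t_gt0 : 0 < t.

Lemma spin_cases (a : spin) : [\/ a = spin_m1, a = spin_0 | a = spin_p1].
Proof.
case: a => v h.
have /= := h; rewrite !inE => /or3P[] /eqP e; move: h; rewrite e => h.
- by apply: Or31; apply: val_inj.
- by apply: Or32; apply: val_inj.
- by apply: Or33; apply: val_inj.
Qed.

Definition p_keep : R := 2^-1 * (1 + expR (- (2 * t))).
Definition p_flip : R := 2^-1 * (1 - expR (- (2 * t))).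

Lemma p_flip_gt0 : 0 < p_flip.
Proof.
rewrite mulr_gt0 ?invr_gt0 ?ltr0n// subr_gt0 -[ltRHS](@expR0 R) ltr_expR.
by rewrite oppr_lt0 mulr_gt0.
Qed.

Lemma p_flip_lt_keep : p_flip < p_keep.
Proof.
rewrite /p_flip /p_keep ltr_pM2l ?invr_gt0 ?ltr0n//.
by have := expR_gt0 (- (2 * t)); lra.
Qed.

Lemma p_keep_gt0 : 0 < p_keep.
Proof. exact: lt_trans p_flip_gt0 p_flip_lt_keep. Qed.

Lemma flipE (a b : spin) : flip t a b =
  if (a == spin_0) || (b == spin_0) then (a == b)%:R
  else if a == b then p_keep else p_flip.
Proof.
rewrite /flip -/p_keep -/p_flip.
have [-> | -> | ->] := spin_cases a; have [-> | -> | ->] := spin_cases b => /=;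
  by rewrite ?(mulr0,mulr1,add0r,addr0).
Qed.

Lemma flip_neq0 (a b : spin) : (flip t a b != 0) = ((a == spin_0) ==
  (b == spin_0)).
Proof.
rewrite flipE.
have [-> | -> | ->] := spin_cases a; have [-> | -> | ->] := spin_cases b => /=;
  by rewrite ?(oner_eq0,eqxx) ?(gt_eqF p_keep_gt0) ?(gt_eqF p_flip_gt0).
Qed.

Lemma flip_ge0 (a b : spin) : 0 <= flip t a b.
Proof.
rewrite flipE; case: ifP => _; first exact: ler0n.
by case: ifP => _; [exact: ltW p_keep_gt0|exact: ltW p_flip_gt0].
Qed.

Lemma flip00 : flip t spin_0 spin_0 = 1.
Proof. by rewrite flipE. Qed.

End flip.

Lemma prod_fsetD (R : comPzRingType) (T : choiceType) (K L : {fset T})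
  (F : T -> R) :
  (K `<=` L)%fset ->
  \prod_(i <- L) F i = (\prod_(i <- K) F i) * \prod_(i <- (L `\` K)%fset) F i.
Proof.
move=> KL; rewrite (big_fsetID _ (mem K)) /=; congr (_ * _); apply: eq_fbigl.
- move=> i; rewrite !inE /=; apply/andP/idP => [[]//|iK].
  by split => //; exact: (fsubsetP KL).
- by move=> i; rewrite !inE /= andbC.
Qed.

Section weights.
Variables (R : realType) (d : nat) (alpha : probability spin R).
Hypothesis alpha_gt0 : forall a, 0 < mass alpha a.
Implicit Types (L K M D : {fset site d}) (x y xi eta omega : config d).

(** Masses relative to the empty site: with this normalization empty sites
weigh 1, and clearing a block removes its factor. *)
Definition activity (a : spin) : R := mass alpha a / mass alpha spin_0.

Lemma activity0 : activity spin_0 = 1.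
Proof. by rewrite /activity divff// gt_eqF. Qed.

Lemma activity_gt0 a : 0 < activity a.
Proof. by rewrite divr_gt0. Qed.

Definition compatible K xi : Prop := forall i j, i \in K -> nn i j ->
  spin_val (xi i) * spin_val (xi j) != -1.

Definition weight K xi : R :=
  (`[< compatible K xi >])%:R * \prod_(i <- K) activity (xi i).

Lemma weight_ge0 K xi : 0 <= weight K xi.
Proof.
by rewrite mulr_ge0 ?ler0n// prodr_ge0// => i _; exact: ltW (activity_gt0 _).
Qed.

Lemma eq_weight K M xi eta : nbhd_in K M ->
  (forall i, i \in M -> xi i = eta i) -> weight K xi = weight K eta.
Proof.
move=> [KM nM] e; rewrite /weight.
have ek i : i \in K -> xi i = eta i by move=> /(fsubsetP KM)/e.
congr ((nat_of_bool _)%:R * _).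
- by apply: asbool_equiv_eq; split => h i j iK ij; have := h i j iK ij;
    rewrite (ek i)// (e j)//; exact: (nM i).
- by apply: eq_big_seq => i iK; rewrite ek.
Qed.

(** When the outer boundary of [D] is empty, the edges leaving [D] impose
nothing. *)
Lemma eq_weight_sealed D xi eta : sealed D xi -> sealed D eta ->
  (forall i, i \in D -> xi i = eta i) -> weight D xi = weight D eta.
Proof.
move=> sx se e; rewrite /weight; congr ((nat_of_bool _)%:R * _).
- apply: asbool_equiv_eq; split => h i j iD ij; have := h i j iD ij;
  have [jD|jD] := boolP (j \in D); rewrite ?(e i iD) ?(e j jD)//.
  + by rewrite (sx i j)// (se i j).
  + by rewrite (sx i j)// (se i j).
- by apply: eq_big_seq => i iK; rewrite e.
Qed.

(** Edges that do not meet [K] do not see that [K] is emptied, and those that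
do become harmless. *)
Lemma weight_split K L xi : (K `<=` L)%fset ->
  weight L xi = weight K xi * weight L (clear K xi).
Proof.
move=> KL; rewrite /weight.
have -> : `[< compatible L xi >] =
    `[< compatible K xi >] && `[< compatible L (clear K xi) >].
  rewrite -asbool_and; apply: asbool_equiv_eq; split => [h|[hK hL] i j iL ij].
  - split=> i j iK ij; first exact: h (fsubsetP KL _ iK) ij.
    rewrite !clearE; case: ifP => _; first by rewrite mul0r.
    by case: ifP => _; [rewrite mulr0|exact: h].
  - have [iK|iK] := boolP (i \in K); first exact: hK.
    have [jK|jK] := boolP (j \in K); first by rewrite mulrC hK// nn_sym.
    by have := hL i j iL ij; rewrite !clearE (negbTE iK) (negbTE jK).
rewrite -mulnb natrM -!mulrA; congr (_ * _); rewrite mulrCA; congr (_ * _).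
rewrite !(prod_fsetD _ KL); congr (_ * _).
rewrite [X in X * _]big1_seq ?mul1r.
- apply: eq_big_seq => i; rewrite !inE => /andP[iK _].
  by rewrite clearE (negbTE iK).
- by move=> i /= iK; rewrite clearE iK activity0.
Qed.

Lemma weight_vacuum K xi : (forall i,
  i \in K -> xi i = spin_0) -> weight K xi = 1.
Proof.
move=> x0; rewrite /weight asboolT => [|i j iK _]; last by rewrite x0// mul0r.
by rewrite mul1r big1_seq// => i /= iK; rewrite x0// activity0.
Qed.

Lemma hc_weightE L eta (s : {ffun L -> spin}) :
  hc_weight alpha eta s =
  mass alpha spin_0 ^+ #|` L| * weight L (extend s eta).
Proof.
rewrite /hc_weight /weight mulrCA; congr (_ * _).
  have [c|c] := pselect (compatible L (extend s eta)).
  - rewrite asboolT// fsbig1// => e [i [j [ij -> /fset0Pn[k]]]].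
    rewrite big_fsetU1/= ?inE ?nn_neq// big_seq_fset1.
    rewrite ?inE => /andP[/orP[]/eqP-> kL].
    + by rewrite c.
    + by rewrite mulrC c// nn_sym.
  - rewrite asboolF//.
    move: c => /existsNP[i] /existsNP[j] /not_implyP[iL] /not_implyP[ij].
    move=> /negP; rewrite negbK => c.
    rewrite (fsbigD1 [fset i; j]%fset)/=.
    + by rewrite big_fsetU1 ?inE ?nn_neq//= big_seq_fset1 c mul0r.
    + exact: sub_finite_set (finite_edges L).
    + exists i, j; split => //; apply/fset0Pn; exists i.
      by rewrite !inE eqxx iL.
rewrite (@big_seq_fsetE _ _ _ _ L) /= /activity big_split /=.
rewrite prodr_const cardfE exprVn mulrCA mulfV ?mulr1; last first.
  by rewrite expf_neq0// gt_eqF.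
by apply: eq_bigr => i _; rewrite extend_val.
Qed.

Lemma hc_unnormalizedE L eta (A : set (config d)) :
  hc_unnormalized alpha L eta A =
  (mass alpha spin_0 ^+ #|` L| *
    block_sum L (fun xi => weight L xi * \1_A xi) eta)%:E.
Proof.
rewrite /hc_unnormalized /block_sum mulr_sumr -sumEFin; apply: eq_bigr => s _.
by rewrite hc_weightE diracE indicE -EFinM mulrA.
Qed.

(** The weight of [L] factors at [K] ([weight_split]), and the factor of [K]
sees nothing beyond the prescribed neighbourhood of [K]: neither the rest of
[L] nor the boundary condition. *)
Lemma hc_unnormalized_cylinder K M L x eta :
  nbhd_in K M -> (M `<=` L)%fset ->
  hc_unnormalized alpha L eta (cylinder M x) =
  ((weight K x)%:E * hc_unnormalized alpha L eta (cylinder M (clear K x)))%E.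
Proof.
move=> nKM ML; have KL : (K `<=` L)%fset := fsubset_trans nKM.1 ML.
rewrite !hc_unnormalizedE -EFinM mulrCA; congr EFin; congr (_ * _).
rewrite !(block_sum_split _ _ KL) /block_sum mulr_sumr; apply: eq_bigr => s _.
set z := extend s eta.
rewrite -/(block_sum K (fun xi => weight L xi * \1_(cylinder M x) xi) z).
rewrite -/(block_sum K (fun xi =>
  weight L xi * \1_(cylinder M (clear K x)) xi) z).
have out y eta' : ~ cylinder K y eta' ->
    weight L eta' * \1_(cylinder M y) eta' = 0.
  move=> nK; rewrite indicE memNset ?mulr0// => h; apply: nK => i iK.
  by rewrite h// (fsubsetP nKM.1).
rewrite (@block_sum_point _ _ _ _ x); last by move=> ? _; exact: out.
rewrite (@block_sum_point _ _ _ _ (clear K x)); last by move=> ? _; exact: out.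
have cl : splice K (clear K x) z = clear K (splice K x z).
  by apply/funext => i; rewrite /clear /splice; case: (i \in K).
rewrite cl (weight_split _ KL) !indicE -mulrA.
have -> : (clear K (splice K x z) \in cylinder M (clear K x)) =
          (splice K x z \in cylinder M x).
  apply/idP/idP => /set_mem h; rewrite in_setE => i iM; have := h i iM;
    by rewrite !clearE /splice; case: (i \in K).
have [h|_] := boolP (splice K x z \in cylinder M x); last by rewrite !mulr0.
by rewrite (eq_weight nKM (set_mem h)).
Qed.

Lemma block_sum_weight_gt0 L eta : 0 < block_sum L (weight L) eta.
Proof.
rewrite /block_sum (bigD1 [ffun=> spin_0])//= ltr_wpDr//.
  by apply: sumr_ge0 => s _; exact: weight_ge0.
rewrite weight_vacuum// => i iL.
by rewrite -[i]/(val [` iL]%fset) extend_val ffunE.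
Qed.

Lemma hc_specificationE L eta (A : set (config d)) :
  hc_specification alpha L eta A =
  (hc_unnormalized alpha L eta A *
   (fine (hc_unnormalized alpha L eta setT))^-1%:E)%E.
Proof.
rewrite /hc_specification /= /mnormalize ifF//.
apply/negbTE/norP; split; rewrite [X in X != _](hc_unnormalizedE L eta setT)//.
rewrite eqe gt_eqF// mulr_gt0 ?exprn_gt0// /block_sum.
under eq_bigr do rewrite indicT mulr1.
exact: block_sum_weight_gt0.
Qed.

End weights.

(** * Summing out the hidden configuration; relative weights of a block *)

Section evolved_weights.
Variables (R : realType) (d : nat) (alpha : probability spin R) (t : R).
Hypothesis alpha_gt0 : forall a, 0 < mass alpha a.
Hypothesis t_gt0 : 0 < t.
Implicit Types (L K M D : {fset site d}) (x y xi eta zeta omega : config d).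
Notation weight := (@weight R d alpha).

Definition flips M omega x : R := \prod_(i <- M) flip t (omega i) (x i).

(** Sum over the configurations [omega] in [M] at time 0, weighted by [phi] and
by the probability that [omega] is observed as [x]. *)
Definition noisy_sum (phi : config d -> R) M x : R :=
  block_sum M (fun omega => phi omega * flips M omega x) vacuum.

(** The Boltzmann weight of [D] with empty surroundings, observed as [x] at
time [t]. *)
Definition evolved D x : R := noisy_sum (weight D) D x.

Lemma flips_ge0 M omega x : 0 <= flips M omega x.
Proof. by apply: prodr_ge0 => i _; exact: flip_ge0. Qed.

Lemma eq_flips M omega omega' x x' :
  (forall i, i \in M -> omega i = omega' i) ->
  (forall i, i \in M -> x i = x' i) -> flips M omega x = flips M omega' x'.
Proof.
by move=> eo ex; apply: eq_big_seq => i iM; rewrite eo ?ex.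
Qed.

Lemma flips_neq0 M omega x i : i \in M -> flips M omega x != 0 ->
  (omega i == spin_0) = (x i == spin_0).
Proof.
move=> iM; rewrite /flips (big_fsetD1 i)//= mulf_eq0 negb_or => /andP[+ _].
by rewrite flip_neq0// => /eqP.
Qed.

Lemma flips_split D M omega x : (D `<=` M)%fset ->
  flips M omega x = flips D omega x * flips (M `\` D)%fset omega x.
Proof. exact: prod_fsetD. Qed.

(** The noise preserves emptiness, so only [omega] that are empty wherever [x]
is contribute.  They seal [D] as [x] does, and the sum over the contents of [D]
decouples from the sum over the rest. *)
Lemma noisy_sum_factor (phi : config d -> R) D M x :
  (D `<=` M)%fset -> sealed D x ->
  (forall omega, phi omega = weight D omega * phi (clear D omega)) ->
  noisy_sum phi M x = evolved D x * noisy_sum phi M (clear D x).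
Proof.
move=> DM sD phiD; rewrite /noisy_sum !(block_sum_split _ _ DM).
rewrite -(@block_sumMl _ _ _ (fun=> evolved D x))//;
  apply: eq_block_sum => zeta z0.
have zD i : i \in D -> zeta i = spin_0 by move=> iD; rewrite z0// !inE iD.
set Q := flips (M `\` D)%fset zeta x.
have F1 : block_sum D (fun omega => phi omega * flips M omega x) zeta =
    phi zeta * Q * block_sum D (fun omega =>
      weight D omega * flips D omega x) zeta.
  rewrite -(@block_sumMl _ _ _ (fun=> phi zeta * Q))//.
  apply: eq_block_sum => omega oz.
  rewrite phiD (eq_clear oz) (clear_eq zD) (flips_split _ _ DM).
  have -> : flips (M `\` D)%fset omega x = Q.
    by apply: eq_flips => // i; rewrite !inE => /andP[iD _]; rewrite oz.
  by ring.
have F2 : block_sum D (fun omega =>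
  phi omega * flips M omega (clear D x)) zeta =
    phi zeta * Q.
  rewrite (@block_sum_point _ _ _ _ vacuum).
  - rewrite -/(clear D zeta) (clear_eq zD) (flips_split _ _ DM); congr (_ * _).
    rewrite [X in X * _](_ : _ = 1) ?mul1r.
    + by apply: eq_flips => // i; rewrite !inE clearE => /andP[/negbTE ->].
    + by apply: big1_seq => i /= iD; rewrite clearE iD zD// flip00.
  - move=> eta _ nD; rewrite (flips_split _ _ DM).
    have [->|h] := eqVneq (flips D eta (clear D x)) 0;
      first by rewrite mul0r mulr0.
    exfalso; apply: nD => i iD; apply/eqP.
    by rewrite (flips_neq0 iD h) clearE iD.
rewrite F1 F2; have [->|Q0] := eqVneq Q 0; first by rewrite !(mulr0,mul0r).
rewrite mulrC; congr (_ * _).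
have sz : sealed D zeta.
  move=> i j iD ij jD; have [jM|jM] := boolP (j \in M).
    apply/eqP; rewrite (flips_neq0 _ Q0) ?inE ?jD ?jM//.
    by rewrite (sD i j).
  by rewrite z0// !inE negb_and jM orbT.
apply: eq_bigr => s _; congr (_ * _).
- apply: eq_weight_sealed => [i j iD ij jD|i j iD ij jD|i iD].
  + by rewrite extend_notin// (sz i j).
  + by rewrite extend_notin.
  + exact: extend_in.
- by apply: eq_flips => // i iD; exact: extend_in.
Qed.

Lemma evolved_gt0 D x : 0 < evolved D x.
Proof.
pose y : config d := fun i => if x i == spin_0 then spin_0 else spin_p1.
rewrite /evolved /noisy_sum /block_sum (bigD1 (restrict D y))//= ltr_wpDr//.
  by apply: sumr_ge0 => s _; rewrite mulr_ge0 ?flips_ge0 ?weight_ge0.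
rewrite extend_restrict mulr_gt0//.
- rewrite mulr_gt0 ?asboolT//.
  + move=> i j _ _; rewrite /splice /vacuum /y.
    by case: ifP; case: ifP => //; case: ifP => //; case: ifP.
  + by rewrite prodr_gt0// => i _; exact: activity_gt0.
- rewrite lt_neqAle flips_ge0 andbT eq_sym prodf_seq_neq0;
  apply/allP => i iD /=.
  by rewrite flip_neq0// /splice iD /y; case: (x i == spin_0).
Qed.

Lemma evolved_factor D M x : (D `<=` M)%fset -> sealed D x ->
  evolved M x = evolved D x * evolved M (clear D x).
Proof.
move=> DM sD; apply: noisy_sum_factor => // omega; exact: weight_split.
Qed.

Lemma eq_evolved D x y : (forall i, i \in D -> x i = y i) ->
  evolved D x = evolved D y.
Proof.
by move=> e; apply: eq_bigr => s _; congr (_ * _); apply: eq_flips.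
Qed.

Definition encloses L D xi : Prop :=
  (forall i, i \in L -> xi i != spin_0 -> i \in D) /\ sealed D xi.

(** Weight of the contents of [L], relative to [L] empty, computed inside a set
[D] that seals off the particles of [L]. *)
Definition odds D L xi : R := evolved D xi / evolved D (clear L xi).

(** The contribution of [M] outside [D] is the same whether [L] is emptied or
not, and cancels. *)
Lemma odds_enlarge L D M xi : encloses L D xi -> (D `<=` M)%fset ->
  odds M L xi = odds D L xi.
Proof.
move=> [LD sD] DM; rewrite /odds (evolved_factor DM sD).
rewrite (evolved_factor DM (sealed_clear L sD)).
have -> : clear D (clear L xi) = clear D xi.
  apply: eq_clear => i iD; rewrite clearE; case: ifPn => // iL.
  by apply/esym/eqP; apply: contraNT iD; exact: LD.
by rewrite -mulf_div divff ?mulr1// gt_eqF// evolved_gt0.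
Qed.

(** By [odds_enlarge] the choice of the enclosing set is immaterial.  The value
0 means that particles of [L] belong to an infinite cluster. *)
Definition tilt L xi : R :=
  if pselect (exists D, encloses L D xi) is left ex
  then odds (projT1 (cid ex)) L xi else 0.

Lemma tiltE L D xi : encloses L D xi -> tilt L xi = odds D L xi.
Proof.
move=> e; rewrite /tilt; case: pselect => [ex|]; last by case; exists D.
case: cid => /= D' e'; rewrite -(odds_enlarge e (fsubsetUl _ D')).
by rewrite -(odds_enlarge e' (fsubsetUr D _)).
Qed.

Lemma tilt_eq0 L xi : ~ (exists D, encloses L D xi) -> tilt L xi = 0.
Proof. by rewrite /tilt; case: pselect. Qed.

Lemma odds_gt0 D L xi : 0 < odds D L xi.
Proof. by rewrite divr_gt0 ?evolved_gt0. Qed.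

Lemma tilt_ge0 L xi : 0 <= tilt L xi.
Proof.
have [[D /tiltE->]|/tilt_eq0-> //] := pselect (exists D, encloses L D xi).
exact: ltW (odds_gt0 _ _ _).
Qed.

Lemma tilt_clear L xi : tilt L (clear L xi) = 1.
Proof.
rewrite (@tiltE _ fset0); last by split => // i iL; rewrite clearE iL.
by rewrite /odds clear_clear// divff// gt_eqF// evolved_gt0.
Qed.

Lemma enclosesS K L D xi : (K `<=` L)%fset -> encloses L D xi ->
  encloses K D xi.
Proof. by move=> KL [h s]; split => // i /(fsubsetP KL); exact: h. Qed.

(** The relative weight of [L] is obtained by emptying [K] first and the rest
of [L] next.  The point is that both sides vanish together: sets enclosing the
particles of [K] in [xi] and those of [L] in [clear K xi] join into a set
enclosing the particles of [L] in [xi]. *)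
Lemma tilt_cocycle K L xi : (K `<=` L)%fset ->
  tilt L xi = tilt K xi * tilt L (clear K xi).
Proof.
move=> KL; have [[D e]|ne] := pselect (exists D, encloses L D xi).
  have eK : encloses L D (clear K xi).
    split; last exact: sealed_clear e.2.
    by move=> i iL; rewrite clearE; case: ifP => // _; exact: e.1.
  rewrite (tiltE e) (tiltE (enclosesS KL e)) (tiltE eK) /odds clear_clear//.
  by rewrite mulrA divfK// gt_eqF// evolved_gt0.
rewrite (tilt_eq0 ne).
have [[D1 e1]|/tilt_eq0->] := pselect (exists D, encloses K D xi); last first.
  by rewrite mul0r.
have [[D2 e2]|/tilt_eq0->] := pselect (exists D, encloses L D (clear K xi));
  last by rewrite mulr0.
exfalso; apply: ne; exists (D1 `|` D2)%fset; split.
- move=> i iL xi0; rewrite inE; have [iK|iK] := boolP (i \in K).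
    by rewrite e1.1.
  by rewrite (e2.1 i iL) ?orbT// clearE (negbTE iK).
- move=> i j; rewrite !inE negb_or => /orP[iD|iD] ij /andP[j1 j2].
    exact: (e1.2 i j).
  have := e2.2 i j iD ij j2; rewrite clearE; case: ifPn => // jK _.
  by apply/eqP; apply: contraNT j1; exact: e1.1.
Qed.

Lemma block_sum_tilt_ge1 L xi : 1 <= block_sum L (tilt L) xi.
Proof.
rewrite /block_sum (bigD1 (restrict L vacuum))//= extend_restrict tilt_clear.
by rewrite lerDl sumr_ge0// => s _; exact: tilt_ge0.
Qed.

Lemma block_sum_tilt_gt0 L xi : 0 < block_sum L (tilt L) xi.
Proof. exact: lt_le_trans ltr01 (block_sum_tilt_ge1 _ _). Qed.

End evolved_weights.

(** * Local sigma-algebras and integrals of local functions *)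

Section local_sigma_algebras.
Variable d : nat.
Implicit Types (S : set (site d)) (L K M D : {fset site d}).

Lemma measurable_coordinate S i (Y : set spin) : S i ->
  measurable ([set w | Y (w i)] : set (config_on S)).
Proof.
move=> Si; apply: sub_sigma_algebra; exists i => //; exists Y => //.
by rewrite setTI.
Qed.

Lemma coordinate_eventsS S S' : S `<=` S' ->
  coordinate_events S `<=` coordinate_events S'.
Proof. exact: bigcup_subset. Qed.

Lemma measurable_onS S S' (A : set (site d -> spin)) : S `<=` S' ->
  measurable (A : set (config_on S)) -> measurable (A : set (config_on S')).
Proof. by move=> SS'; exact: sub_sigma_algebra2 (coordinate_eventsS SS') _. Qed.

Lemma measurable_onW S (A : set (site d -> spin)) :
  measurable (A : set (config_on S)) -> measurable (A : set (config d)).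
Proof. exact: measurable_onS. Qed.

(** Events in the sigma-algebra of the coordinates in [S] are unions of
classes of configurations agreeing on [S], since such unions form a
sigma-algebra. *)
Lemma measurable_on_saturated S (A : set (config_on S)) : measurable A ->
  forall w w', (forall i, S i -> w i = w' i) -> A w -> A w'.
Proof.
pose C := [set B : set (site d -> spin) |
  forall w w', (forall i, S i -> w i = w' i) -> B w -> B w'].
have CE : sigma_algebra setT C.
  split.
  - by [].
  - move=> B CB w w' ww' [_ nB]; split => // Bw'; apply: nB.
    by apply: CB Bw' => i Si; rewrite ww'.
  - by move=> F CF w w' ww' [n _ Fn]; exists n => //; exact: CF Fn.
suff h : <<s coordinate_events S >> `<=` C by move=> /h.
apply: smallest_sub => // _ [i Si] [Y _ <-] w w' ww'.
by rewrite !setTI /preimage /= ww'.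
Qed.

Lemma measurable_funW (R : realType) S (f : config d -> \bar R) :
  measurable_fun [set: config_on S] f -> measurable_fun [set: config d] f.
Proof.
move=> mf _ Y mY; have := mf measurableT Y mY; rewrite !setTI.
exact: measurable_onW.
Qed.

Lemma measurable_on_eq (R : realType) S (f : config d ->
  R) : measurable_on S f ->
  forall w w', (forall i, S i -> w i = w' i) -> f w = f w'.
Proof.
move=> mf w w' ww'.
have := mf measurableT [set f w] (measurable_set1 _); rewrite setTI => mA.
by apply/esym; exact: (measurable_on_saturated mA ww').
Qed.

Lemma measurable_cylinder_on S M (x : config d) : [set` M] `<=` S ->
  measurable (cylinder M x : set (config_on S)).
Proof.
move=> MS; rewrite (_ : cylinder M x =
    \bigcap_(i in [set` M]) [set eta | [set x i] (eta i)]) //.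
apply: fin_bigcap_measurable => // i /MS Si.
exact: measurable_coordinate.
Qed.

Lemma measurable_cylinder M (x : config d) :
  measurable (cylinder M x : set (config d)).
Proof. exact: measurable_cylinder_on. Qed.

Lemma measurable_local_set M (A : set (config d)) :
  (forall w w', (forall i, i \in M -> w i = w' i) -> A w -> A w') ->
  measurable (A : set (config_on [set` M])).
Proof.
move=> satA; rewrite (_ : A = \bigcup_(s in [set s : {ffun M -> spin} |
   A (extend s vacuum)]) cylinder M (extend s vacuum)).
  apply: fin_bigcup_measurable => [|s _]; first exact: finite_finset.
  exact: measurable_cylinder_on.
apply/seteqP; split => [w Aw|w [s As h]].
- exists (restrict M w) => /= [|i iM]; rewrite extend_restrict ?/splice ?iM//.
  by apply: satA Aw => i; rewrite /splice => ->.
- by apply: satA As => i iM; rewrite h.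
Qed.

(** A function of the configuration composed with the prescription of the block
[L] no longer depends on [L]; this is what makes the kernels measurable with
respect to the outside of [L]. *)
Lemma measurable_extend L (s : {ffun L -> spin}) :
  measurable_fun [set: config_on (~` [set` L])]
    (extend s : config d -> config d).
Proof.
apply: (@measurability _ _ (config_on (~` [set` L])) (config d) setT _
  (coordinate_events setT)) => // _ [_ [i _ [Y mY <-]] <-].
rewrite !setTI; have [iL|iL] := boolP (i \in L).
- have [Ys|Ys] := pselect (Y (s [` iL]%fset)).
  + rewrite [X in measurable X](_ : _ = setT); first exact: measurableT.
    by apply/seteqP; split => // w _ /=;
      rewrite -[i]/(val [` iL]%fset) extend_val.
  + rewrite [X in measurable X](_ : _ = set0); first exact: measurable0.
    by apply/seteqP; split => // w /=;
      rewrite -[i]/(val [` iL]%fset) extend_val.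
- rewrite [X in measurable X](_ : _ = [set w : site d -> spin | Y (w i)]).
    by apply: measurable_coordinate; exact/negP.
  by apply/seteqP; split => w /=; rewrite extend_notin.
Qed.

End local_sigma_algebras.

Section block_measure.
Variables (R : realType) (d : nat) (L : {fset site d}).
Variables (g : config d -> {nonneg R}) (eta : config d).
Local Open Scope ereal_scope.

Definition block_measure (A : set (config d)) : \bar R :=
  (block_sum L (fun xi => (g xi)%:num * \1_A xi)%R eta)%:E.

Let conf (k : nat) : config d :=
  extend (nth [ffun=> spin_0] (enum {: {ffun L -> spin}}) k) eta.

Let m (k : nat) : {measure set (config d) -> \bar R} :=
  mscale (g (conf k)) \d_(conf k).

Let msumE (F : config d -> \bar R) :
  \sum_(k < #|{: {ffun L -> spin}}|) F (conf k) =
  \sum_(s : {ffun L -> spin}) F (extend s eta).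
Proof.
rewrite [RHS](reindex_onto enum_val enum_rank); last by move=> s _;
  rewrite enum_rankK.
apply: eq_big => [k|k _]; first by rewrite enum_valK eqxx.
by rewrite /conf (enum_val_nth [ffun=> spin_0]).
Qed.

Lemma block_measureE : block_measure = msum m #|{: {ffun L -> spin}}|.
Proof.
apply/funext => A; rewrite /block_measure /block_sum -sumEFin /msum.
rewrite -(msumE (fun xi => ((g xi)%:num * \1_A xi)%:E)).
by apply: eq_bigr => k _; rewrite /m /= /mscale /= diracE indicE EFinM.
Qed.

Let bm0 : block_measure set0 = 0.
Proof. by rewrite block_measureE measure0. Qed.

Let bm_ge0 A : 0 <= block_measure A.
Proof. by rewrite block_measureE. Qed.

Let bm_sigma_additive : semi_sigma_additive block_measure.
Proof. rewrite block_measureE; exact: measure_semi_sigma_additive. Qed.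

HB.instance Definition _ :=
  isMeasure.Build _ _ _ block_measure bm0 bm_ge0 bm_sigma_additive.

Lemma integral_block_measure (f : config d -> \bar R) :
  measurable_fun setT f -> (forall xi, 0 <= f xi) ->
  \int[block_measure]_xi f xi =
  \sum_(s : {ffun L -> spin}) (g (extend s eta))%:num%:E * f (extend s eta).
Proof.
move=> mf f0; rewrite (@eq_measure_integral _ _ _ _ (msum m #|{: {ffun L ->
  spin}}|)).
- rewrite ge0_integral_measure_sum//.
  rewrite -(msumE (fun xi => (g xi)%:num%:E * f xi)).
  apply: eq_bigr => k _; rewrite ge0_integral_mscale//.
  by rewrite integral_dirac// diracE mem_set// mul1e.
- by move=> A _ _; exact: (congr1 (fun F => F A) block_measureE).
Qed.

End block_measure.

Section local_integrals.
Variables (R : realType) (d : nat) (mu : probability (config d) R).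
Implicit Types (L K M D : {fset site d}) (x y xi eta omega : config d).

Definition prob M x : R := fine (mu (cylinder M x)).

Lemma probE M x : mu (cylinder M x) = (prob M x)%:E.
Proof.
rewrite /prob fineK// fin_num_measure//; exact: measurable_cylinder.
Qed.

Lemma prob_ge0 M x : 0 <= prob M x.
Proof. exact: fine_ge0. Qed.

(** A local function is a finite combination of indicators of cylinders. *)
Lemma integral_local M (h : config d -> R) :
  (forall w w', (forall i, i \in M -> w i = w' i) -> h w = h w') ->
  (forall w, 0 <= h w) ->
  (\int[mu]_w (h w)%:E =
    (block_sum M (fun omega => h omega * prob M omega) vacuum)%:E)%E.
Proof.
move=> hM h0.
have e w : ((h w)%:E = \sum_(s : {ffun M -> spin})
    (h (extend s vacuum))%:E * (\1_(cylinder M (extend s vacuum)) w)%:E)%E.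
  rewrite (bigD1 (restrict M w))//= big1 ?adde0.
  - rewrite extend_restrict indicE mem_set ?mule1; last first.
      by move=> i iM; rewrite /splice iM.
    by congr EFin; apply: hM => i iM; rewrite /splice iM.
  - move=> s sw; rewrite indicE memNset ?mule0// => h'; move/eqP: sw; apply.
    apply/ffunP => j; rewrite ffunE (h' _ (valP j)).
    by rewrite extend_val.
rewrite (eq_integral _ _ (fun w _ => e w)) ge0_integral_sum//.
- rewrite /block_sum -sumEFin; apply: eq_bigr => s _.
  rewrite ge0_integralZl//; last exact: h0.
  + rewrite integral_indic//; last exact: measurable_cylinder.
    by rewrite setIT EFinM; congr (_ * _)%E; exact: probE.
  + by apply/measurable_EFinP; apply: measurable_indic;
    exact: measurable_cylinder.
- move=> s; apply: measurable_funeM; apply/measurable_EFinP.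
  by apply: measurable_indic; exact: measurable_cylinder.
- by move=> s w _; rewrite mule_ge0// lee_fin ?h0.
Qed.

End local_integrals.

(** * Measurability over countably many finite sets *)

Section countable_pieces.
Variable d : nat.
Implicit Types (L K M D : {fset site d}).

Lemma measurable_sealed D : measurable ([set xi | sealed D xi] : set
  (config d)).
Proof.
have [M [DM nM]] := nbhd_exists D.
apply: (@measurable_onW _ [set` M]); apply: measurable_local_set => w w' e.
by apply: eq_sealed => i j iD ij _; rewrite e//; exact: (nM i).
Qed.

Lemma measurable_fset_bigcup (F : {fset site d} -> set (config d)) :
  (forall D, measurable (F D)) -> measurable (\bigcup_D F D).
Proof. exact/countable_bigcupT_measurable/countableP. Qed.

Lemma measurable_encloses L D :
  measurable ([set xi | encloses L D xi] : set (config d)).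
Proof.
rewrite (_ : mkset _ = [set xi : config d | forall i,
  i \in L -> xi i != spin_0 -> i \in D]
    `&` [set xi | sealed D xi]); last by apply/seteqP; split.
apply: measurableI; last exact: measurable_sealed.
apply: (@measurable_onW _ [set` L]);
  apply: measurable_local_set => w w' e h i iL.
by rewrite -e//; exact: h.
Qed.

(** Cylinders form a pi-system generating the product sigma-algebra. *)
Lemma measure_cylinder_unique (R : realType)
    (m1 m2 : {measure set (config d) -> \bar R}) :
  (forall M x, m1 (cylinder M x) = m2 (cylinder M x)) ->
  (m1 setT < +oo)%E ->
  forall A, measurable A -> m1 A = m2 A.
Proof.
move=> m12 m1fin A mA.
pose G : set (set (config d)) := [set A | A = set0 \/ exists M x,
  A = cylinder M x].
have cylT : cylinder fset0 vacuum = [set: config d] by apply/seteqP; split.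
apply: (measure_unique G (fun=> setT)) => //.
- apply/seteqP; split.
  + apply: smallest_sub; first exact: smallest_sigma_algebra.
    move=> _ [i _ [Y mY <-]]; rewrite setTI.
    rewrite (_ : _ @^-1` _ = \bigcup_(a in Y) cylinder [fset i]%fset (fun=> a)).
      apply: (@fin_bigcup_measurable _ (g_sigma_algebraType G)) => [|a _].
        exact: finite_finset.
      by apply: sub_sigma_algebra; right; exists [fset i]%fset, (fun=> a).
    apply/seteqP; split => [w Yw|w [a Ya h]] /=.
    * by exists (w i) => // j; rewrite inE => /eqP->.
    * by rewrite h// inE.
  + apply: smallest_sub; first exact: smallest_sigma_algebra.
    move=> _ [->|[M [x ->]]]; first exact: measurable0.
    exact: measurable_cylinder.
- move=> A1 A2 [->|[M1 [x1 ->]]]; first by left; rewrite set0I.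
  move=> [->|[M2 [x2 ->]]]; first by left; rewrite setI0.
  have [[w [h1 h2]]|/forallNP ne] :=
      pselect (exists w, (cylinder M1 x1 `&` cylinder M2 x2) w).
    right; exists (M1 `|` M2)%fset, w; apply/seteqP; split => [v [g1 g2] i|v g].
    + by rewrite inE => /orP[iM|iM];
      [rewrite (g1 i iM) (h1 i iM)|rewrite (g2 i iM) (h2 i iM)].
    + by split=> i iM; rewrite g ?inE ?iM ?orbT// ?(h1 i iM)// (h2 i iM).
  by left; apply/seteqP; split => // w /ne.
- by move=> k; right; exists fset0, vacuum.
- by rewrite bigcup_const//; exists 0%N.
- by move=> _ [->|[M [x ->]]]; rewrite ?measure0.
Qed.

(** An increasing exhaustion of the lattice by finite sets; its shape is
immaterial, so an enumeration of the sites is enough. *)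
Definition box (n : nat) : {fset site d} :=
  seq_fset tt (pmap (@choice.unpickle (site d)) (iota 0 n)).


Lemma box_exists M : exists n, forall m, (n <= m)%N -> (M `<=` box m)%fset.
Proof.
exists (\max_(i <- M) (choice.pickle i).+1)%N => m nm; apply/fsubsetP => i iM.
rewrite seq_fsetE mem_pmap; apply/mapP; exists (choice.pickle i);
  last by rewrite choice.pickleK.
rewrite mem_iota /= add0n; apply: leq_trans nm.
by rewrite (bigD1_seq i)//= leq_max leqnn.
Qed.

Lemma subset_box m n : (m <= n)%N -> (box m `<=` box n)%fset.
Proof.
move=> mn; apply/fsubsetP => i; rewrite !seq_fsetE !mem_pmap => /mapP[k].
rewrite mem_iota add0n => /andP[_ km] e; apply/mapP; exists k => //.
by rewrite mem_iota /= add0n (leq_trans km).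
Qed.

End countable_pieces.

(** * A specification whose bad configurations have an infinite cluster *)

Section evolved_specification.
Variables (R : realType) (d : nat) (alpha : probability spin R) (t : R).
Hypothesis alpha_gt0 : forall a, 0 < mass alpha a.
Hypothesis t_gt0 : 0 < t.
Implicit Types (L K M D : {fset site d}) (x y xi eta zeta omega : config d).
Notation tilt := (@tilt R d alpha t).
Notation odds := (@odds R d alpha t).

Definition tilt_nng L xi : {nonneg R} := NngNum (tilt_ge0 alpha_gt0 t_gt0 L xi).

Definition evolved_specification : kernel_family R d :=
  fun L eta => mnormalize (block_measure L (tilt_nng L) eta) \d_(clear L eta).
Notation gamma := evolved_specification.

Lemma block_sum_tilt_neq0 L eta : block_sum L (tilt L) eta != 0.
Proof. by rewrite gt_eqF// block_sum_tilt_gt0. Qed.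

Lemma evolved_specificationE L eta (A : set (config d)) :
  gamma L eta A = (block_sum L (fun xi => tilt L xi * \1_A xi) eta /
                   block_sum L (tilt L) eta)%:E.
Proof.
have mE : block_measure L (tilt_nng L) eta setT = (block_sum L (tilt L) eta)%:E.
  by rewrite /block_measure /block_sum; under eq_bigr do rewrite indicT mulr1.
rewrite /gamma /= /mnormalize ifF; first by rewrite [X in fine X]mE -EFinM.
apply/negbTE/norP; split; rewrite [X in X != _]mE//.
by rewrite eqe block_sum_tilt_neq0.
Qed.

Lemma integral_evolved_specification L eta (f : config d -> R) :
  measurable_fun [set: config d] f -> (forall xi, 0 <= f xi) ->
  (\int[gamma L eta]_xi (f xi)%:E =
    (block_sum L (fun xi => tilt L xi * f xi) eta /
     block_sum L (tilt L) eta)%:E)%E.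
Proof.
move=> mf f0.
have Z0 : 0 <= (block_sum L (tilt L) eta)^-1.
  by rewrite invr_ge0 ltW// block_sum_tilt_gt0.
rewrite (@eq_measure_integral _ _ _ _
  (mscale (NngNum Z0) (block_measure L (tilt_nng L) eta))).
- have mEf : measurable_fun [set: config d] (EFin \o f).
    exact/measurable_EFinP.
  rewrite ge0_integral_mscale//; last by move=> xi _; rewrite lee_fin.
  rewrite [X in (_ * X)%E](@integral_block_measure _ _ L (tilt_nng L) eta
    (EFin \o f) mEf);
    last by move=> xi; rewrite lee_fin.
  rewrite mulrC EFinM; congr (_ * _)%E.
  by rewrite /block_sum -sumEFin; apply: eq_bigr => s _; rewrite EFinM.
- move=> A _ _; rewrite [LHS](evolved_specificationE L eta A) mulrC EFinM.
  by rewrite /= /mscale.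
Qed.

(** On each of the countably many events that [D] encloses the particles of
[L], the relative weight is a local function. *)
Lemma measurable_tilt L : measurable_fun [set: config d] (tilt L).
Proof.
move=> _ Y mY; rewrite setTI.
have mo D : measurable ([set xi | Y (odds D L xi)] : set (config d)).
  apply: (@measurable_onW _ [set` (D `|` L)%fset]).
  apply: measurable_local_set => w w' e /=.
  suff -> : odds D L w = odds D L w' by [].
  rewrite /odds; congr (_ / _); apply: eq_evolved => i iD.
    by rewrite e// inE iD.
  by rewrite !clearE e// inE iD.
pose E D := [set xi : config d | encloses L D xi].
have -> : tilt L @^-1` Y =
    (\bigcup_D (E D `&` [set xi : config d | Y (odds D L xi)])) `|`
    ((~` \bigcup_D E D) `&` [set xi : config d | Y 0]).
  apply/seteqP; split => [xi|xi [[D _ [e]]|[ne]]] /=.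
  - have [[D e]|ne] := pselect (exists D, encloses L D xi).
      by rewrite (tiltE _ _ e)// => Yxi; left; exists D.
    rewrite tilt_eq0// => Y0; right; split => // -[D _ e].
    by apply: ne; exists D.
  - by rewrite (tiltE _ _ e).
  - by rewrite tilt_eq0// => -[D e]; apply: ne; exists D.
apply: measurableU; first apply: measurable_fset_bigcup => D.
  exact: measurableI (measurable_encloses L D) (mo D).
apply: measurableI.
  apply: measurableC; apply: measurable_fset_bigcup => D.
  exact (measurable_encloses L D).
have [Y0|Y0] := pselect (Y 0).
  rewrite [X in measurable X](_ : _ = setT); first exact: measurableT.
  by apply/seteqP; split.
rewrite [X in measurable X](_ : _ = set0); first exact: measurable0.
by apply/seteqP; split.
Qed.

Lemma measurable_block_sum L (f : config d -> R) :
  measurable_fun [set: config d] f ->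
  measurable_on (~` [set` L]) (block_sum L f).
Proof.
move=> mf; apply: measurable_sum => s.
exact: (measurableT_comp mf (@measurable_extend _ _ s)).
Qed.

Lemma evolved_specification_measurable L (A : set (config d)) :
  measurable A -> measurable_on (~` [set` L]) (fun w => gamma L w A).
Proof.
move=> mA; rewrite /measurable_on.
have mZ : measurable_fun [set: config_on (~` [set` L])]
    (fun w : config d => (block_sum L (tilt L) w)^-1).
  have mZ' : measurable_fun [set: config_on (~` [set` L])]
      ((@powR R ^~ (-1)) \o (block_sum L (tilt L) : config d -> R)).
    apply: measurableT_comp; first exact: measurable_powR.
    exact: measurable_block_sum (measurable_tilt L).
  move: mZ'; apply: eq_measurable_fun => xi _ /=.
  by rewrite powR_inv1// ltW// block_sum_tilt_gt0.
have mq : measurable_fun [set: config_on (~` [set` L])] (fun w : config d =>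
    (block_sum L (fun xi =>
      tilt L xi * \1_A xi) w / block_sum L (tilt L) w)%:E).
  apply/measurable_EFinP; apply: measurable_funM => //.
  apply: measurable_block_sum; apply: measurable_funM;
    first exact: measurable_tilt.
  exact: measurable_indic.
by move: mq; apply: eq_measurable_fun => w _; rewrite evolved_specificationE.
Qed.

Lemma evolved_specification_setI L eta (A B : set (config d)) :
  (forall w w', (forall i, i \notin L -> w i = w' i) -> B w -> B w') ->
  gamma L eta (A `&` B) = ((\1_B eta)%:E * gamma L eta A)%E.
Proof.
move=> satB; rewrite !evolved_specificationE -EFinM mulrA; congr (_ / _)%:E.
rewrite -(@block_sumMl _ _ _ (fun=> \1_B eta))//.
apply: eq_block_sum => xi e; rewrite mulrCA; congr (_ * _).
rewrite indicI /= mulrC; congr (_ * _); rewrite !indicE;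
  congr (nat_of_bool _)%:R.
apply/idP/idP => /set_mem h; apply/mem_set.
- by apply: satB h => i /e.
- by apply: satB h => i /e ->.
Qed.

Lemma evolved_specification_setT L eta : gamma L eta setT = 1%E.
Proof. exact: probability_setT. Qed.

Lemma evolved_specification_proper L (B : set (config_on (~` [set` L]))) :
  measurable B -> forall w, gamma L w B = (\1_B w)%:E.
Proof.
move=> mB w; rewrite -[X in gamma L w X]setTI evolved_specification_setI.
  by rewrite evolved_specification_setT mule1.
move=> v v' e; apply: (measurable_on_saturated mB) => i iL; apply: e.
exact/negP.
Qed.

(** Resampling [K] inside the resampled [L]: by the cocycle identity the weight
of [L] is, for fixed contents of [L] outside [K], proportional to the weight of
[K], so the inner average is already taken with the right weights. *)
Lemma evolved_specification_consistent K L : (K `<=` L)%fset ->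
  forall A : set (config d), measurable A ->
  forall w, (\int[gamma L w]_x gamma K x A)%E = gamma L w A.
Proof.
move=> KL A mA w.
pose r xi := block_sum K (fun xi =>
  tilt K xi * \1_A xi) xi / block_sum K (tilt K) xi.
have rE xi : gamma K xi A = (r xi)%:E by rewrite evolved_specificationE.
have r0 xi : 0 <= r xi by rewrite -lee_fin -rE.
have mr : measurable_fun [set: config d] r.
  apply/measurable_EFinP.
  have := @measurable_funW _ _ _ _ (@evolved_specification_measurable K A mA).
  by apply: eq_measurable_fun => xi _; rewrite rE.
under eq_integral do rewrite rE.
rewrite integral_evolved_specification// evolved_specificationE.
congr (_ / _)%:E; rewrite !(block_sum_split _ _ KL).
apply: eq_block_sum => zeta _.
have cl xi : (forall i,
  i \notin K -> xi i = zeta i) -> tilt L (clear K xi) = tilt L (clear K zeta).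
  by move=> /eq_clear ->.
have rK xi : (forall i, i \notin K -> xi i = zeta i) -> r xi = r zeta.
  by move=> e; rewrite /r !(eq_block_sum_off _ e).
transitivity (tilt L (clear K zeta) * r zeta * block_sum K (tilt K) zeta).
  rewrite -(@block_sumMl _ _ _ (fun=> tilt L (clear K zeta) * r zeta))//.
  apply: eq_block_sum => xi e.
  by rewrite (tilt_cocycle alpha_gt0 t_gt0 xi KL) cl// rK//; ring.
rewrite -mulrA /r divfK ?block_sum_tilt_neq0//.
rewrite -(@block_sumMl _ _ _ (fun=> tilt L (clear K zeta)))//.
apply: eq_block_sum => xi e.
by rewrite (tilt_cocycle alpha_gt0 t_gt0 xi KL) cl//; ring.
Qed.

Lemma evolved_specificationP : is_specification gamma.
Proof.
split.
- exact: evolved_specification_measurable.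
- exact: evolved_specification_proper.
- exact: evolved_specification_consistent.
Qed.

(** This holds exactly when all clusters are finite. *)
Definition surrounded xi : Prop := forall i, exists D, i \in D /\ sealed D xi.

Lemma surrounded_fset xi L : surrounded xi ->
  exists D, (L `<=` D)%fset /\ sealed D xi.
Proof.
move=> sxi.
suff [D [LD sD]] : exists D, {subset (L : seq (site d)) <= D} /\ sealed D xi.
  by exists D; split => //; exact/fsubsetP.
elim: (L : seq (site d)) => [|i s [D [LD sD]]].
  by exists fset0; split => // i j; rewrite inE.
have [D' [iD' sD']] := sxi i; exists (D' `|` D)%fset; split;
  last exact: sealedU.
by move=> j; rewrite !inE => /orP[/eqP->|/LD->]; rewrite ?iD' ?orbT.
Qed.

Lemma measurable_surrounded : measurable ([set xi | surrounded xi] : set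
  (config d)).
Proof.
rewrite (_ : mkset _ = \bigcap_(i in [set: site d])
    \bigcup_(D in [set: {fset site d}])
      [set xi : config d | i \in D /\ sealed D xi]); last first.
  by apply/seteqP; split => xi h i; have := h i;
    [move=> [D hD] _; exists D|move=> /(_ I)[D _ hD]; exists D].
rewrite -[X in measurable X]setCK setC_bigcap; apply: measurableC.
apply: countable_bigcupT_measurable; first exact: countableP.
move=> i; apply: measurableC; apply: measurable_fset_bigcup => D.
have [iD|iD] := boolP (i \in D).
  rewrite [X in measurable X](_ : _ = [set xi | sealed D xi]).
    exact: measurable_sealed.
  by apply/seteqP; split => xi //= [].
rewrite [X in measurable X](_ : _ = set0); first exact: measurable0.
by apply/seteqP; split => xi //= [].
Qed.

(** Inside a finite set sealed by [eta] the kernel is computed from [eta] alone,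
whatever happens far away; the difference in the definition of a bad
configuration is then eventually 0. *)
Lemma bad_not_surrounded : bad gamma `<=` ~` [set xi | surrounded xi].
Proof.
move=> eta [D [f [z1 [z2 [[L0 mf] [l l_gt0 cvl]]]]]] seta.
have [D' [DD' sD']] := surrounded_fset D seta.
have [M nM] := nbhd_exists D'.
suff e : \forall L \near totally, \int[gamma D (splice L eta z1)]_x f x =
    \int[gamma D (splice L eta z2)]_x f x.
  suff : l = 0 by move/eqP; rewrite gt_eqF.
  have c0 : (fun L => `|\int[gamma D (splice L eta z1)]_x f x -
      \int[gamma D (splice L eta z2)]_x f x|) @ totally --> (0 : R).
    apply: cvg_near_cst; near=> L.
    have -> : \int[gamma D (splice L eta z1)]_x f x =
      \int[gamma D (splice L eta z2)]_x f x by near: L.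
    by rewrite subrr normr0.
  exact: (cvg_unique _ cvl c0).
exists (L0 `|` M)%fset => // L /= L0ML.
have agree z i : i \in (L0 `|` M)%fset -> splice L eta z i = eta i.
  by move=> /(fsubsetP L0ML) iL; rewrite /splice iL.
have agree_ext s z i : i \in (L0 `|` M)%fset ->
    extend (s : {ffun D -> spin}) (splice L eta z) i = extend s eta i.
  move=> iM; have [iD|iD] := boolP (i \in D); first exact: extend_in.
  by rewrite !extend_notin// agree.
have tiltE' s z : tilt D (extend (s : {ffun D -> spin}) (splice L eta z)) =
    tilt D (extend s eta).
  have enc : encloses D D' (extend s eta).
    split=> [i iD _|i j iD ij jD]; first exact: (fsubsetP DD').
    rewrite extend_notin; first exact: (sD' i j).
    by apply: contraNN jD; exact: (fsubsetP DD').
  have ag i : i \in M -> extend s (splice L eta z) i = extend s eta i.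
    by move=> iM; apply: agree_ext; rewrite inE iM orbT.
  have enc' : encloses D D' (extend s (splice L eta z)).
    split; first by move=> i iD _; exact: (fsubsetP DD').
    by apply: eq_sealed enc.2 => i j iD ij _; rewrite ag//; exact: (nM.2 i).
  rewrite (tiltE _ _ enc)// (tiltE _ _ enc')// /odds.
  have agD i : i \in D' -> extend s (splice L eta z) i = extend s eta i.
    by move=> iD; apply: ag; exact: (fsubsetP nM.1).
  by congr (_ / _); apply: eq_evolved => i iD; rewrite ?clearE agD.
have main (h : config d -> R) : measurable_fun [set: config_on [set` L0]] h ->
    (forall xi, 0 <= h xi) ->
    (\int[gamma D (splice L eta z1)]_x (h x)%:E =
     \int[gamma D (splice L eta z2)]_x (h x)%:E)%E.
  move=> mh h0.
  have mh' : measurable_fun [set: config d] h.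
    by move=> _ Y mY; rewrite setTI; have := mh measurableT Y mY;
      rewrite setTI; exact: measurable_onW.
  rewrite !integral_evolved_specification//.
  have hE s z : h (extend (s : {ffun D ->
    spin}) (splice L eta z)) = h (extend s eta).
    apply: (measurable_on_eq mh) => i iL0; apply: agree_ext.
    by rewrite inE iL0.
  by rewrite /block_sum; congr (_ / _)%:E; apply: eq_bigr => s _;
    rewrite ?hE ?tiltE'.
(* The integrands may have any sign: compare positive and negative parts. *)
rewrite /Rintegral; congr fine; rewrite integralE [RHS]integralE.
have -> : (fun x => (f x)%:E)^\+%E = (fun x => (Num.max (f x) 0)%:E).
  by apply/funext => x; rewrite funeposE EFin_max.
have -> : (fun x => (f x)%:E)^\-%E = (fun x => (Num.max (- f x) 0)%:E).
  by apply/funext => x; rewrite funenegE EFin_max.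
congr (_ - _)%E; apply: main.
- by apply: measurable_maxr => //; exact: measurable_cst.
- by move=> x; rewrite le_max lexx orbT.
- apply: measurable_maxr; last exact: measurable_cst.
  exact: measurableT_comp.
- by move=> x; rewrite le_max lexx orbT.
Unshelve. all: by end_near. Qed.


End evolved_specification.

(** * The evolved measure is admitted *)

Section admitted.
Variables (R : realType) (d : nat) (alpha : probability spin R) (t : R).
Hypothesis alpha_gt0 : forall a, 0 < mass alpha a.
Hypothesis t_gt0 : 0 < t.
Variable mut : probability (config d) R.
Implicit Types (L K M D : {fset site d}) (x y xi eta zeta omega : config d).
Notation tilt := (@tilt R d alpha t).
Notation odds := (@odds R d alpha t).
Notation evolved := (@evolved R d alpha t).
Notation gamma := (@evolved_specification R d alpha t alpha_gt0 t_gt0).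

Hypothesis prob_factor : forall D M x, nbhd_in D M -> sealed D x ->
  prob mut M x = evolved D x * prob mut M (clear D x).
Hypothesis mut_surrounded : mut (~` [set xi | surrounded xi]) = 0%E.

Section resampling.
Variable L : {fset site d}.

Definition surrounded_within n : set (config d) :=
  [set xi | exists D, [/\ (L `<=` D)%fset, nbhd_in D (box d n) & sealed D xi]].

Lemma surrounded_within_off n xi eta : (forall i, i \notin L -> xi i = eta i) ->
  surrounded_within n xi -> surrounded_within n eta.
Proof.
move=> e [D [LD nD sD]]; exists D; split => //;
  apply: eq_sealed sD => i j iD ij jD.
by apply: e; apply: contraNN jD; exact: (fsubsetP LD).
Qed.

Lemma surrounded_within_local n xi eta : (forall i,
  i \in box d n -> xi i = eta i) ->
  surrounded_within n xi -> surrounded_within n eta.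
Proof.
move=> e [D [LD nD sD]]; exists D; split => //;
  apply: eq_sealed sD => i j iD ij jD.
by apply: e; exact: (nD.2 i).
Qed.

Lemma measurable_surrounded_within n : measurable (surrounded_within n).
Proof.
apply: (@measurable_onW _ [set` box d n]); apply: measurable_local_set => w w'.
exact: surrounded_within_local.
Qed.

Lemma nondecreasing_surrounded_within : nondecreasing_seq surrounded_within.
Proof.
move=> m n mn; apply/subsetPset => xi [D [LD nD sD]]; exists D; split => //.
exact: nbhd_inS nD (subset_box _ mn).
Qed.

Lemma bigcup_surrounded_within :
  [set xi | surrounded xi] `<=` \bigcup_n surrounded_within n.
Proof.
move=> xi /(surrounded_fset L)[D [LD sD]].
have [M nM] := nbhd_exists D; have [n Mn] := box_exists M.
by exists n => //; exists D; split => //; exact: nbhd_inS nM (Mn n _).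
Qed.

(** The evolved measure and the specification weigh the contents of [L]
alike. *)
Lemma prob_tilt n xi : surrounded_within n xi ->
  prob mut (box d n) xi = tilt L xi * prob mut (box d n) (clear L xi).
Proof.
move=> [D [LD nD sD]]; have enc : encloses L D xi.
  by split=> // i iL _; exact: (fsubsetP LD).
rewrite (tiltE _ _ enc)// /odds (prob_factor nD sD).
rewrite (prob_factor nD (sealed_clear L sD)) clear_clear//.
by rewrite mulrA divfK// gt_eqF// evolved_gt0.
Qed.

(** For local events inside [surrounded_within n] both sides are finite sums
over the configurations in [box d n], and for fixed contents outside [L] the
two sums over the contents of [L] agree by [prob_tilt]. *)
Lemma resample_local n (E : set (config d)) :
  (L `<=` box d n)%fset -> E `<=` surrounded_within n ->
  (forall w w', (forall i, i \in box d n -> w i = w' i) -> E w -> E w') ->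
  (\int[mut]_eta gamma L eta E)%E = mut E.
Proof.
move=> LB EG Eloc.
pose num eta := block_sum L (fun xi => tilt L xi * \1_E xi) eta.
pose den eta := block_sum L (tilt L) eta.
have num0 eta : ~ surrounded_within n eta -> num eta = 0.
  move=> nG; rewrite /num /block_sum big1// => s _.
  rewrite indicE memNset ?mulr0// => /EG; apply: contra_not nG.
  by apply: surrounded_within_off => i iL; rewrite extend_notin.
have tilt_loc w w' s : surrounded_within n w -> surrounded_within n w' ->
    (forall i, i \in box d n -> w i = w' i) ->
    tilt L (extend (s : {ffun L -> spin}) w) = tilt L (extend s w').
  move=> [D [LD nD sD]] _ ww'.
  have ext i : i \in box d n -> extend s w i = extend s w' i.
    move=> iB; have [iL|iL] := boolP (i \in L); first exact: extend_in.
    by rewrite !extend_notin// ww'.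
  have se : sealed D (extend s w).
    apply: eq_sealed sD => i j iD ij jD; rewrite extend_notin//.
    by apply: contraNN jD; exact: (fsubsetP LD).
  have enc : encloses L D (extend s w) by split=> // i iL _;
    exact: (fsubsetP LD).
  have enc' : encloses L D (extend s w').
    split=> [i iL _|]; first exact: (fsubsetP LD).
    by apply: eq_sealed se => i j iD ij _; apply: ext; exact: (nD.2 i).
  rewrite (tiltE _ _ enc)// (tiltE _ _ enc')//; congr (_ / _);
    apply: eq_evolved => i iD; rewrite ?clearE ext//; exact: (fsubsetP nD.1).
pose h eta := num eta / den eta.
have hloc w w' : (forall i, i \in box d n -> w i = w' i) -> h w = h w'.
  move=> ww'; have [gw|gw] := pselect (surrounded_within n w); last first.
    have gw' : ~ surrounded_within n w'.
      by move=> g; apply/gw/(surrounded_within_local _ g) => i iB; rewrite ww'.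
    by rewrite /h (num0 _ gw) (num0 _ gw') !mul0r.
  have gw' := surrounded_within_local ww' gw.
  rewrite /h /num /den /block_sum; congr (_ / _); apply: eq_bigr => s _;
    rewrite (tilt_loc w w' s)//.
  rewrite !indicE; congr (_ * _); congr (nat_of_bool _)%:R.
  have ext i : i \in box d n -> extend s w i = extend s w' i.
    move=> iB; have [iL|iL] := boolP (i \in L); first exact: extend_in.
    by rewrite !extend_notin// ww'.
  apply/idP/idP => /set_mem h'; apply/mem_set; first exact: Eloc ext h'.
  by apply: Eloc h' => i iB; rewrite ext.
have h0 w : 0 <= h w.
  rewrite divr_ge0//; last by rewrite ltW// block_sum_tilt_gt0.
  by apply: sumr_ge0 => s _; rewrite mulr_ge0// tilt_ge0.
have mE : measurable E.
  by apply: (@measurable_onW _ [set` box d n]); exact: measurable_local_set.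
under eq_integral do rewrite evolved_specificationE.
rewrite (integral_local mut hloc h0).
have -> : mut E = (\int[mut]_w (\1_E w)%:E)%E by rewrite integral_indic// setIT.
rewrite (@integral_local _ _ _ (box d n)); first last.
- by move=> w; rewrite indicE.
- move=> w w' ww'; rewrite !indicE; congr (nat_of_bool _)%:R.
  apply/idP/idP => /set_mem h'; apply/mem_set; first exact: Eloc ww' h'.
  by apply: Eloc h' => i iB; rewrite ww'.
congr EFin; rewrite !(block_sum_split _ _ LB); apply: eq_block_sum => zeta _.
have hL eta : (forall i, i \notin L -> eta i = zeta i) -> h eta = h zeta.
  by move=> e; rewrite /h /num /den !(eq_block_sum_off _ e).
rewrite (@block_sumMl _ _ _ h)//.
have [g|g] := pselect (surrounded_within n zeta); last first.
  rewrite /h (num0 _ g) !mul0r /block_sum big1// => s _.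
  rewrite indicE memNset ?mul0r// => /EG; apply: contra_not g.
  by apply: surrounded_within_off => i iL; rewrite extend_notin.
have pE eta : (forall i, i \notin L -> eta i = zeta i) ->
    prob mut (box d n) eta = prob mut (box d n) (clear L zeta) * tilt L eta.
  move=> e; rewrite prob_tilt; first by rewrite (eq_clear e) mulrC.
  by apply: surrounded_within_off g => i /e ->.
have -> : block_sum L (prob mut (box d n)) zeta =
    prob mut (box d n) (clear L zeta) * den zeta.
  rewrite /den -(@block_sumMl _ _ _ (fun=> prob mut (box d n)
    (clear L zeta)))//.
  exact: eq_block_sum.
rewrite /h mulrCA divfK ?block_sum_tilt_neq0//.
rewrite /num -(@block_sumMl _ _ _ (fun=> prob mut (box d n) (clear L zeta)))//.
by apply: eq_block_sum => eta e; rewrite (pE _ e); ring.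
Qed.

Let measurable_gamma E : measurable E ->
  measurable_fun [set: config d] (fun eta => gamma L eta E).
Proof.
move=> mE; exact: @measurable_funW _ _ _ _
  (@evolved_specification_measurable _ _ _ _ alpha_gt0 t_gt0 L E mE).
Qed.

Definition resampled (E : set (config d)) : \bar R :=
  (\int[mut]_eta gamma L eta E)%E.

Let resampled0 : resampled set0 = 0%E.
Proof. by rewrite /resampled integral0_eq// => eta _; rewrite measure0. Qed.

Let resampled_ge0 E : (0 <= resampled E)%E.
Proof. exact: integral_ge0. Qed.

Let resampled_sigma_additive : semi_sigma_additive resampled.
Proof.
move=> U mU tU mUU; rewrite [X in _ --> X](_ : _ =
  (\int[mut]_eta (\sum_(n <oo) gamma L eta (U n)))%E); last first.
  apply: eq_integral => V _.
  by apply/esym/cvg_lim => //; exact/measure_semi_sigma_additive.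
apply/cvg_closeP; split.
  by apply: is_cvg_nneseries => n _ _; exact: integral_ge0.
rewrite closeE// integral_nneseries// => n.
exact: measurable_gamma.
Qed.

HB.instance Definition _ := isMeasure.Build _ _ R resampled
  resampled0 resampled_ge0 resampled_sigma_additive.

(** A cylinder meets [surrounded_within n] in a local event, to which
[resample_local] applies; let [n] tend to infinity.  What is left out is null
for the evolved measure, and also after resampling, because being enclosed does
not depend on the contents of [L]. *)
Lemma resampledE E : measurable E -> resampled E = mut E.
Proof.
pose T := \bigcup_n surrounded_within n.
have mT : measurable T.
  by apply: bigcupT_measurable => n; exact: measurable_surrounded_within.
have mutT : mut (~` T) = 0%E.
  apply: (subset_measure0 _ _ _ mut_surrounded).
  - exact: measurableC.
  - by apply: measurableC; exact: measurable_surrounded.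
  - by apply: subsetC; exact: bigcup_surrounded_within.
have resT : resampled (~` T) = 0%E.
  have <- : (\int[mut]_w (\1_(~` T) w)%:E)%E = 0%E.
    by rewrite integral_indic ?setIT//; exact: measurableC.
  apply: eq_integral => eta _.
  rewrite -[X in gamma L eta X]setTI evolved_specification_setI.
    by rewrite evolved_specification_setT mule1.
  move=> w w' ww' nT; apply: contra_not nT => -[n _ gn]; exists n => //.
  by apply: surrounded_within_off gn => i iL; rewrite ww'.
apply: (@measure_cylinder_unique _ _ resampled mut) => [M x|]; last first.
  have r1 : resampled setT = 1%E.
    rewrite /resampled; under eq_integral do rewrite evolved_specification_setT.
    by rewrite integral_cst// mul1e; exact: probability_setT.
  by rewrite [ltLHS]r1 ltry.
set C := cylinder M x; have mC : measurable C := measurable_cylinder M x.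
have split_T (m : {measure set (config d) -> \bar R}) :
    m (~` T) = 0%E -> m C = m (C `&` T).
  move=> m0; rewrite -[in LHS](setIT C) -(setUv T) setIUr measureU//.
  - rewrite [X in (_ + X)%E](_ : _ = 0%E) ?adde0//.
    apply: (subset_measure0 _ _ _ m0); [|exact: measurableC|exact: subIsetr].
    by apply: measurableI => //; exact: measurableC.
  - exact: measurableI.
  - by apply: measurableI => //; exact: measurableC.
  - by rewrite setIACA setICr setI0.
rewrite (split_T mut mutT) (split_T resampled resT).
have CT : C `&` T = \bigcup_n
  (C `&` surrounded_within n) by rewrite setI_bigcupr.
have mCn n : measurable (C `&` surrounded_within n).
  by apply: measurableI => //; exact: measurable_surrounded_within.
have nd : nondecreasing_seq (fun n => C `&` surrounded_within n).
  move=> m n mn; apply/subsetPset; apply: setIS.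
  exact/subsetPset/nondecreasing_surrounded_within.
have mCT : measurable (\bigcup_n (C `&` surrounded_within n)).
  by apply: bigcupT_measurable => n; exact: mCn.
have c1 := nondecreasing_cvg_mu (mu := resampled) mCn mCT nd.
have c2 := nondecreasing_cvg_mu (mu := mut) mCn mCT nd.
rewrite CT; apply: (cvg_unique (@ereal_hausdorff R) c1).
move: c2; apply: cvg_trans; apply: near_eq_cvg.
have [n MLn] := box_exists (M `|` L)%fset.
near=> k; rewrite /= /resampled.
have kn : (n <= k)%N by near: k; exact: nbhs_infty_ge.
have /fsubUsetP [Mk Lk] := MLn _ kn.
rewrite (@resample_local k)// => w w' ww' [Cw gw].
split; last exact: surrounded_within_local gw.
by move=> i iM; rewrite -ww' ?Cw//; exact: (fsubsetP Mk).
Unshelve. all: by end_near. Qed.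


End resampling.

(** Invariance under resampling of [L] is the DLR equation: an event outside
[L] is unaffected by resampling and can be moved into the kernel. *)
Lemma evolved_specification_admitted : admitted gamma mut.
Proof.
move=> L A mA; split; first exact: evolved_specification_measurable.
move=> B mB; rewrite integral_mkcond.
have satB w w' : (forall i, i \notin L -> w i = w' i) -> B w -> B w'.
  by move=> e; apply: (measurable_on_saturated mB) => i /negP; exact: e.
rewrite -(@resampledE L); last first.
  by apply: measurableI => //; exact: measurable_onW mB.
apply: eq_integral => eta _; rewrite evolved_specification_setI// patchE indicE.
by case: ifPn => _; rewrite ?mul1e ?mul0e.
Qed.

End admitted.

(** * Low intensity: almost every configuration is surrounded by empty sites *)

Lemma negligible_countable_bigcup (R : realType) (d0 : measure_display)
    (T : measurableType d0) (m : {measure set T -> \bar R}) (I : countType)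
    (F : I -> set T) :
  (forall i, m.-negligible (F i)) -> m.-negligible (\bigcup_i F i).
Proof.
move=> F0.
pose G n := if @choice.unpickle I n is Some i then F i else set0.
apply: (@negligibleS _ _ _ _ (\bigcup_n G n)) => [w [i _ Fi]|].
  by exists (choice.pickle i) => //; rewrite /G choice.pickleK.
apply: negligible_bigcup => n; rewrite /G; case: choice.unpickle => [i|].
  exact: F0.
exact: negligible_set0.
Qed.

Section clusters.
Variables (R : realType) (d : nat).
Implicit Types (w : config d) (i j : site d) (D L : {fset site d}).

Definition cluster_of w i : set (site d) :=
  [set j | exists p, [/\ path (@nn d) i p, last i p = j &
                        [set` i :: p] `<=` occupied w]].

Lemma cluster_of_path w i p : path (@nn d) i p ->
  [set` i :: p] `<=` occupied w ->
  [set` i :: p] `<=` cluster_of w i.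
Proof.
move=> ip po j jp; case/splitPl: jp ip po => p1 p2 <-.
rewrite cat_path => /andP[ip1 _] po; exists p1; split => // k /= kp.
by apply: po; rewrite /= -cat_cons mem_cat kp.
Qed.

Lemma cluster_of_refl w i : occupied w i -> cluster_of w i i.
Proof. by move=> wi; exists [::]; split => // j /=; rewrite inE => /eqP->. Qed.

Lemma cluster_of_connected w i : nn_connected (cluster_of w i).
Proof.
move=> j k [p [ip <- po]] [q [iq qk qo]].
have lastr : last (last i p) (rev (belast i p)) = i.
  by case: p {ip po} => //= a p; rewrite rev_cons last_rcons.
exists (rev (belast i p) ++ q); split.
- rewrite cat_path lastr iq andbT rev_path.
  by rewrite (eq_path (e' := @nn d))// => a b; rewrite nn_sym.
- by rewrite last_cat lastr.
- move=> a /=; rewrite mem_cat mem_rev => /orP[/mem_belast|] ap.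
    exact: (cluster_of_path ip po).
  by apply: (cluster_of_path iq qo); rewrite /= inE ap orbT.
Qed.

Lemma cluster_of_cluster w i : occupied w i -> is_cluster w (cluster_of w i).
Proof.
move=> wi; split.
- by exists i; exact: cluster_of_refl.
- by move=> j [p [_ <- po]]; apply: po => /=; exact: mem_last.
- exact: cluster_of_connected.
- move=> C' CC' C'w C'c; apply/seteqP; split => // j C'j.
  have [p [ip pj pC]] := C'c _ _ (CC' _ (cluster_of_refl wi)) C'j.
  exists p; split => // k /=; rewrite inE => /orP[/eqP->//|kp].
  exact/C'w/pC.
Qed.

Lemma is_clusterE w C i : is_cluster w C -> C i -> C = cluster_of w i.
Proof.
move=> [_ Cw Cc Cmax] Ci; apply/esym; apply: Cmax.
- move=> j Cj; have [p [ip pj pC]] := Cc _ _ Ci Cj.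
  exists p; split => // k /=; rewrite inE => /orP[/eqP->|kp]; apply: Cw => //.
  exact: pC.
- by have [] := cluster_of_cluster (Cw _ Ci).
- exact: cluster_of_connected.
Qed.

(** A path of occupied sites cannot leave a sealed set, and a finite cluster is
itself sealed.  The right-hand side is the form in which the event is
measurable. *)
Lemma infinite_cluster_of w i : occupied w i ->
  infinite_set (cluster_of w i) <-> (forall D, i \in D -> ~ sealed D w).
Proof.
move=> wi; split=> [inf D iD sD|nD fin].
- apply: inf; apply: (@sub_finite_set _ _ [set` D]); last exact: finite_fset.
  move=> j [p [ip <- po]];
    elim: p i iD wi ip po => //= a p IH i iD wi /andP[ia ap] po.
  have wa : occupied w a by apply: po; rewrite /= !inE eqxx orbT.
  apply: IH => //; last by move=> k kp; apply: po; rewrite /= inE; apply/orP;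
    right.
  by apply: contraPT wa => aD; rewrite /occupied /= (sD i a)// eqxx.
- apply: (nD (fset_set (cluster_of w i))).
    by rewrite in_fset_set// mem_set//; exact: cluster_of_refl.
  move=> a b; rewrite !in_fset_set// => /set_mem[p [ip pa po]] ab /negP bC.
  apply/eqP/negPn/negP => wb; apply: bC; apply/mem_set; exists (rcons p b);
    split.
  + by rewrite rcons_path ip pa.
  + by rewrite last_rcons.
  + move=> k /=; rewrite inE mem_rcons inE => /or3P[/eqP->//|/eqP->//|kp].
    by apply: po; rewrite /= inE kp orbT.
Qed.

(** Even an empty site must be enclosed: one takes the site together with sets
enclosing its occupied neighbours.  Failure therefore comes from an occupied
site. *)
Lemma not_surrounded w : ~ surrounded w ->
  exists i, occupied w i /\ forall D, i \in D -> ~ sealed D w.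
Proof.
apply: contra_notP => /forallNP h i.
have occ j : occupied w j -> exists D, j \in D /\ sealed D w.
  move=> wj; apply: contrapT => /forallNP nD; apply: (h j); split=> // D jD sD.
  exact: (nD D).
have list_occ (s : seq (site d)) : exists D,
    (forall j, j \in s -> occupied w j -> j \in D) /\ sealed D w.
  elim: s => [|j s [D [sD Dw]]]; first by exists fset0; split => // ? ?;
    rewrite inE.
  have [wj|wj] := pselect (occupied w j).
    have [D' [jD' sD']] := occ j wj; exists (D' `|` D)%fset.
    split; last exact: sealedU.
    by move=> k; rewrite !inE => /orP[/eqP->|ks wk]; rewrite ?jD'// sD ?orbT.
  by exists D; split => // k; rewrite inE => /orP[/eqP->//|]; exact: sD.
have [M [iM nM]] := nbhd_exists [fset i]%fset.
have [D [MD sD]] := list_occ M.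
exists (i |` D)%fset; split; first by rewrite !inE eqxx.
move=> a b; rewrite !inE negb_or =>
  /orP[/eqP-> ib /andP[_ bD]|aD ab /andP[_ bD]].
- apply/eqP/negPn/negP => wb; move/negP: bD; apply; apply: MD => //.
  by apply: (nM i) => //; rewrite inE.
- exact: (sD a b).
Qed.

(** Countably many events, one per site, cover the complement; each is the
event that a given site lies in an infinite cluster.  Measurability of the
latter is needed to conclude, as a measure has no prescribed value on other
sets. *)
Lemma low_intensity_surrounded (mu : probability (config d) R) :
  low_intensity mu -> mu (~` [set w | surrounded w]) = 0%E.
Proof.
move=> low.
pose S i := [set w : config d | occupied w i /\ forall D,
  i \in D -> ~ sealed D w].
have mS i : measurable (S i).
  have -> : S i = [set w | [set~ spin_0] (w i)] `&`
      ~` (\bigcup_(D in [set: {fset site d}]) [set w : config d | i \in D /\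
        sealed D w]).
    apply/seteqP; split => w [wi h]; split.
    - by apply/eqP.
    - by move=> [D _ [iD sD]]; exact: (h D).
    - by apply/eqP.
    - by move=> D iD sD; apply: h; exists D.
  apply: measurableI; first exact: measurable_coordinate.
  apply: measurableC; apply: measurable_fset_bigcup => D.
  have [iD|iD] := boolP (i \in D).
    rewrite [X in measurable X](_ : _ = [set xi | sealed D xi]).
      exact: measurable_sealed.
    by apply/seteqP; split => xi //= [].
  rewrite [X in measurable X](_ : _ = set0); first exact: measurable0.
  by apply/seteqP; split => xi //= [].
have S0 i : mu (S i) = 0%E.
  apply/eqP; rewrite eq_le measure_ge0 andbT leNgt; apply/negP => Spos.
  apply: low; exists [fset i]%fset; move: Spos; congr (_ < mu _)%E.
  apply/seteqP; split => [w [wi h]|w [C [cC infC [j [Cj]]]]] /=.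
  - exists (cluster_of w i); split.
    + exact: cluster_of_cluster.
    + exact/infinite_cluster_of.
    + by exists i; split; [exact: cluster_of_refl|rewrite /= inE].
  - rewrite /= inE => /eqP ji; rewrite ji in Cj.
    have wi : occupied w i by case: cC => _ + _ _; exact.
    by split => //; apply/infinite_cluster_of => //;
      rewrite -(is_clusterE cC Cj).
apply/negligibleP; first by apply: measurableC; exact: measurable_surrounded.
apply: (@negligibleS _ _ _ _ (\bigcup_i S i)).
  by move=> w /not_surrounded[i Si]; exists i.
apply: negligible_countable_bigcup => i.
by apply/negligibleP; [exact: mS|exact: S0].
Qed.

End clusters.

(** * The clearing rule and the time evolution *)

Section markov_field.
Variables (R : realType) (d : nat) (alpha : probability spin R).
Hypothesis alpha_gt0 : forall a, 0 < mass alpha a.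
Implicit Types (L K M D : {fset site d}) (x y xi eta omega : config d).
Notation weight := (@weight R d alpha).

(** The DLR equations tested on cylinders.  The weight is local, so the rule
passes to limits along local functions. *)
Definition clearing_rule (mu : probability (config d) R) : Prop :=
  forall K M x, nbhd_in K M ->
  prob mu M x = weight K x * prob mu M (clear K x).

Lemma hc_specification_cylinder K M L x eta : nbhd_in K M -> (M `<=` L)%fset ->
  hc_specification alpha L eta (cylinder M x) =
  ((weight K x)%:E * hc_specification alpha L eta (cylinder M (clear K x)))%E.
Proof.
move=> nKM ML; rewrite !hc_specificationE//.
by rewrite (hc_unnormalized_cylinder alpha_gt0 _ _ nKM ML) muleA.
Qed.

Lemma Gibbs_clearing_rule mu : Gibbs_measures
  (@hc_specification R d alpha) mu ->
  clearing_rule mu.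
Proof.
move=> G K M x nKM; apply: EFin_inj; rewrite EFinM -!probE.
have DLR (A : set (config d)) : measurable A ->
    mu A = (\int[mu]_w hc_specification alpha M w A)%E.
  move=> mA; have [_ /(_ setT measurableT)] := G M A mA.
  by rewrite setIT.
have [mh _] := G M _ (measurable_cylinder M (clear K x)).
rewrite !DLR; [|exact: measurable_cylinder..].
under eq_integral do rewrite (hc_specification_cylinder x _ nKM
  (fsubset_refl _)).
rewrite ge0_integralZl//; first exact: measurable_funW mh.
by rewrite lee_fin; exact: weight_ge0.
Qed.

Lemma Rintegral_indic (mu : probability (config d) R) (A : set (config d)) :
  measurable A -> \int[mu]_w (\1_A w : R) = fine (mu A).
Proof. by move=> mA; rewrite /Rintegral integral_indic// setIT. Qed.

Lemma plus_clearing_rule mu : is_plus_measure alpha mu -> clearing_rule mu.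
Proof.
move=> plus K M x nKM.
have cvgc y : fine (hc_specification alpha L (@plus_config d)
  (cylinder M y)) @[L --> totally] -->
    prob mu M y.
  have loc : local (\1_(cylinder M y) : config d -> R).
    exists M; apply: measurable_indic; exact: measurable_cylinder_on.
  have := plus _ loc; rewrite Rintegral_indic; last exact: measurable_cylinder.
  under eq_fun do rewrite (Rintegral_indic _ (measurable_cylinder M y)).
  by [].
have c1 := cvgc x.
have c2 : weight K x * fine (hc_specification alpha L (@plus_config d)
  (cylinder M (clear K x)))
    @[L --> totally] --> weight K x * prob mu M (clear K x).
  exact: cvgM (cvg_cst _) (cvgc _).
apply: (cvg_unique (@Rhausdorff R) c1); move: c2; apply: cvg_trans.
apply: near_eq_cvg.
exists M => // L /= ML.
rewrite (hc_specification_cylinder x _ nKM ML) fineM//.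
by rewrite fin_num_measure//; exact: measurable_cylinder.
Qed.

(** Some cylinder on a neighbourhood of [M] has positive probability; by the
rule it keeps a positive probability once [M] is emptied. *)
Lemma clearing_rule_vacuum mu M : clearing_rule mu -> 0 < prob mu M vacuum.
Proof.
move=> rule; have [M' nM] := nbhd_exists M.
have tot : block_sum M' (fun omega => 1 * prob mu M' omega) vacuum = 1 :> R.
  apply: EFin_inj; rewrite -(@integral_local _ _ mu M' (fun=> 1))//.
  by rewrite integral_cst// mul1e; exact: probability_setT.
have [s ps] : exists s : {ffun M' -> spin}, 0 < prob mu M' (extend s vacuum).
  apply: contrapT => /forallNP h; move/eqP: tot.
  rewrite /block_sum big1 ?(eq_sym 0) ?oner_eq0// => s _; rewrite mul1r.
  by apply/eqP; rewrite eq_le prob_ge0 andbT leNgt; apply/negP/h.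
rewrite (rule M M' _ nM) in ps.
have p0 : 0 < prob mu M' (clear M (extend s vacuum)).
  rewrite lt_neqAle prob_ge0 andbT eq_sym; apply: contraTneq ps => ->.
  by rewrite mulr0 ltxx.
apply: lt_le_trans p0 _; rewrite -lee_fin -!probE.
apply: le_measure; rewrite ?inE; [exact: measurable_cylinder..|].
by move=> eta h i iM; rewrite h ?clearE ?iM//; exact: (fsubsetP nM.1).
Qed.

End markov_field.

Section time_evolution.
Variables (R : realType) (d : nat) (alpha : probability spin R) (t : R).
Hypothesis alpha_gt0 : forall a, 0 < mass alpha a.
Hypothesis t_gt0 : 0 < t.
Variables mu mut : probability (config d) R.
Hypothesis evol : is_time_evolution t mu mut.
Hypothesis rule : clearing_rule alpha mu.
Implicit Types (L K M D : {fset site d}) (x y xi eta omega : config d).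

Lemma prob_evolved M x : prob mut M x = noisy_sum t (prob mu M) M x.
Proof.
have [P flipP evolP] := evol.
apply: EFin_inj; rewrite -probE.
have -> : mut (cylinder M x) = (\int[mut]_eta (\1_(cylinder M x) eta)%:E)%E.
  by rewrite integral_indic ?setIT//; exact: measurable_cylinder.
have mcyl : measurable_fun setT (fun eta : config d =>
  (\1_(cylinder M x) eta : R)%:E).
  by apply/measurable_EFinP; apply: measurable_indic;
    exact: measurable_cylinder.
rewrite (evolP _ mcyl); last by move=> w; rewrite lee_fin.
transitivity (\int[mu]_w (flips t M w x)%:E)%E.
  apply: eq_integral => w _; rewrite integral_indic ?setIT//;
    last exact: measurable_cylinder.
  exact: flipP.
transitivity (block_sum M (fun w => flips t M w x * prob mu M w) vacuum)%:E.
  apply: integral_local => [w w' ww'|w]; first exact: eq_flips.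
  exact: flips_ge0.
by congr EFin; apply: eq_bigr => s _; rewrite mulrC.
Qed.

Lemma prob_evolved_factor D M x : nbhd_in D M -> sealed D x ->
  prob mut M x = evolved alpha t D x * prob mut M (clear D x).
Proof.
move=> nD sD; rewrite !prob_evolved; apply: noisy_sum_factor => //;
  first exact: nD.1.
by move=> omega; exact: rule.
Qed.

Lemma prob_evolved_vacuum M : 0 < prob mut M vacuum.
Proof.
rewrite prob_evolved /noisy_sum (@block_sum_point _ _ _ _ vacuum).
- have -> : splice M vacuum vacuum = vacuum := clear_vacuum M.
  rewrite mulr_gt0//; first exact: clearing_rule_vacuum rule.
  by rewrite prodr_gt0// => i _; rewrite flip00.
- move=> eta _ nM; have [->|h] := eqVneq (flips t M eta vacuum) 0.
    by rewrite mulr0.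
  by exfalso; apply: nM => i iM; apply/eqP; rewrite (flips_neq0 t_gt0 iM h).
Qed.

(** Almost surely the evolution leaves the set of occupied sites unchanged, and
being surrounded is a property of that set. *)
Lemma evolved_surrounded : mu (~` [set xi | surrounded xi]) = 0%E ->
  mut (~` [set xi | surrounded xi]) = 0%E.
Proof.
move=> mu0; have [P flipP evolP] := evol.
set N := ~` _; have mN : measurable N.
  by apply: measurableC; exact: measurable_surrounded.
have -> : mut N = (\int[mut]_eta
  (\1_N eta)%:E)%E by rewrite integral_indic ?setIT.
have m1N : measurable_fun setT (fun eta : config d => (\1_N eta : R)%:E).
  by apply/measurable_EFinP; apply: measurable_indic.
rewrite (evolP _ m1N); last by move=> w; rewrite lee_fin.
apply/eqP; rewrite eq_le integral_ge0 ?andbT; last first.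
  by move=> w _; apply: integral_ge0 => v _; rewrite lee_fin.
rewrite -[leRHS]mu0 -[leRHS]/(mu N).
have -> : mu N = (\int[mu]_eta
  (\1_N eta)%:E)%E by rewrite integral_indic ?setIT.
have PE w : (\int[P w]_v
  (\1_N v)%:E)%E = P w N by rewrite integral_indic ?setIT.
under eq_integral do rewrite PE.
apply: ge0_le_integral => //.
- exact: measurable_kernel.
move=> w _; rewrite indicE; have [wN|] := boolP (w \in N).
  rewrite -[leRHS](@prob_kernel _ _ _ _ _ P w).
  by apply: le_measure; rewrite ?inE.
rewrite notin_setE /N /= => /contrapT sw.
(* The null events that site [u.1] shows the value [u.2] although this changes
   whether it is occupied. *)
pose E (u : site d * spin) : set (config d) :=
  if (w u.1 == spin_0) == (u.2 == spin_0) then set0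
  else cylinder [fset u.1]%fset (fun=> u.2).
suff -> : P w N = 0%E by [].
apply/negligibleP => //; apply: (@negligibleS _ _ _ _ (\bigcup_u E u)).
  move=> v nsv; apply: contrapT => nE; apply: nsv.
  have vw i : (v i == spin_0) = (w i == spin_0).
    apply: contrapT => ne; apply: nE; exists (i, v i) => //.
    rewrite /E /= ifF; last by apply/negP => /eqP e; apply: ne.
    by move=> j; rewrite inE => /eqP->.
  move=> i; have [D [iD sD]] := sw i; exists D; split => // a b aD ab bD.
  by apply/eqP; rewrite vw (sD a b).
apply: negligible_countable_bigcup => -[i a]; rewrite /E /=.
case: ifPn => [_|ne]; first exact: negligible_set0.
apply/negligibleP; first exact: measurable_cylinder.
apply: etrans (flipP w (fun=> a) [fset i]%fset) _.
rewrite big_seq_fset1; congr EFin.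
by apply/eqP; apply: contraNT ne; rewrite flip_neq0.
Qed.


End time_evolution.

(** * A long occupied segment *)

Section monochromatic_clusters.
Variables (R : realType) (d : nat) (alpha : probability spin R) (t : R).
Hypothesis alpha_gt0 : forall a, 0 < mass alpha a.
Hypothesis t_gt0 : 0 < t.
Implicit Types (C : {fset site d}) (x : config d) (a b e : spin).
Notation activity := (activity alpha).

(** Contribution of a site observed as [a] in a cluster of hidden sign [e]. *)
Definition color_factor e a : R :=
  if a == spin_0 then 1 else activity e * flip t e a.

Definition paint e x : config d := fun i => if x i == spin_0 then spin_0 else e.

(** If the particles of [x] in [C] are forced to share one sign, two hidden
configurations remain. *)
Lemma evolved_monochromatic C x i0 : i0 \in C -> x i0 != spin_0 ->
  (forall omega, compatible C omega ->
    (forall i, i \in C -> (omega i == spin_0) = (x i == spin_0)) ->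
    forall i, i \in C -> x i != spin_0 -> omega i = omega i0) ->
  evolved alpha t C x =
  \prod_(i <- C) color_factor spin_p1 (x i) +
  \prod_(i <- C) color_factor spin_m1 (x i).
Proof.
move=> i0C x0 mono.
have term e : e != spin_0 -> spin_val e * spin_val e != -1 ->
    weight alpha C (extend (restrict C (paint e x)) vacuum) *
    flips t C (extend (restrict C (paint e x)) vacuum) x =
    \prod_(i <- C) color_factor e (x i).
  move=> e0 ee; rewrite extend_restrict /weight asboolT; last first.
    move=> i j _ _; rewrite /splice /paint /vacuum.
    case: (i \in C); last by rewrite mul0r.
    case: (x i == spin_0); first by rewrite mul0r.
    case: (j \in C); last by rewrite mulr0.
    by case: (x j == spin_0); first by rewrite mulr0.
  rewrite mul1r /flips -big_split /=; apply: eq_big_seq => i iC.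
  rewrite /splice iC /paint /color_factor; case: ifPn => // /eqP ->.
  by rewrite activity0// flip00 mulr1.
have pm : restrict C (paint spin_m1 x) != restrict C (paint spin_p1 x).
  apply/negP => /eqP /ffunP /(_ [` i0C]%fset).
  by rewrite !ffunE /paint /= (negbTE x0) => /(congr1 spin_val).
rewrite /evolved /noisy_sum /block_sum (bigD1 (restrict C
  (paint spin_p1 x)))//=.
rewrite term//; congr (_ + _).
rewrite (bigD1 (restrict C (paint spin_m1 x)))//= term//.
rewrite [X in _ + X]big1 ?addr0// => s /andP[sp sm].
have [->|fl] := eqVneq (flips t C (extend s vacuum) x) 0;
  first by rewrite mulr0.
rewrite /weight; case: asboolP => [comp|_]; last by rewrite !mul0r.
exfalso; have occ i : i \in C ->
  (extend s vacuum i == spin_0) = (x i == spin_0).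
  by move=> iC; exact: (flips_neq0 t_gt0 iC fl).
have sE e : extend s vacuum i0 = e -> s = restrict C (paint e x).
  move=> s0; apply/ffunP => j; rewrite ffunE /paint.
  have := occ _ (valP j); case: (boolP (x (val j) == spin_0)) => xj.
    by move=> /eqP; rewrite extend_val.
  by move=> _; rewrite -s0 -(mono _ comp occ _ (valP j) xj) extend_val.
have := occ _ i0C; have [e|e|e] := spin_cases (extend s vacuum i0).
- by move: sm; rewrite (sE _ e) eqxx.
- by rewrite e eqxx (negbTE x0).
- by move: sp; rewrite (sE _ e) eqxx.
Qed.

End monochromatic_clusters.

Section segments.
Variables (R : realType) (d : nat) (hd : (0 < d)%N).
Variables (alpha : probability spin R) (t : R).
Hypothesis alpha_gt0 : forall a, 0 < mass alpha a.
Hypothesis t_gt0 : 0 < t.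
Implicit Types (L M D : {fset site d}) (x y : config d) (a c e : spin).
Let j0 : 'I_d := Ordinal hd.

Definition axis (k : nat) : site d := \row_j (if j == j0 then k%:Z else 0).

Definition axis_index (i : site d) : nat := `|i ord0 j0|%N.

Lemma axisK : cancel axis axis_index.
Proof. by move=> k; rewrite /axis_index mxE eqxx absz_nat. Qed.

Lemma nn_axis k : nn (axis k) (axis k.+1).
Proof.
rewrite /nn (bigD1 j0)//= big1 ?addr0.
- by rewrite !mxE eqxx -addn1 PoszD opprD addrA subrr sub0r normrN.
- by move=> j /negbTE jj0; rewrite !mxE jj0 subrr normr0.
Qed.

Definition segment m : {fset site d} := seq_fset tt (map axis (iota 0 m.+1)).

Lemma in_segment m i : (i \in segment m) = (i \in map axis (iota 0 m.+1)).
Proof. exact: seq_fsetE. Qed.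

Lemma axis_in_segment m k : (axis k \in segment m) = (k <= m)%N.
Proof.
rewrite in_segment mem_map; last exact: can_inj axisK.
by rewrite mem_iota.
Qed.

Lemma segmentP m i : i \in segment m -> exists2 k, (k <= m)%N & i = axis k.
Proof.
by rewrite in_segment => /mapP[k]; rewrite mem_iota => km ->; exists k.
Qed.

Lemma prod_segment m (F : site d -> R) :
  \prod_(i <- segment m) F i = \prod_(0 <= k < m.+1) F (axis k).
Proof.
rewrite (perm_big (map axis (iota 0 m.+1))) ?big_map ?subn0//.
apply: uniq_perm; [exact: fset_uniq| |exact: in_segment].
by rewrite map_inj_uniq ?iota_uniq//; exact: can_inj axisK.
Qed.

(** The first [n] sites after the origin are common to the two patterns to be
compared and cover a given finite volume; the choice of [c] on the [k] sites
beyond it decides the likely hidden sign. *)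
Definition pattern a n k c : config d := fun i =>
  if i \in segment (n + k) then
    if axis_index i == 0%N then a
    else if (axis_index i <= n)%N then spin_p1 else c
  else spin_0.

Definition color_weight e n k c : R :=
  color_factor alpha t e spin_p1 ^+ n * color_factor alpha t e c ^+ k.

Lemma pattern_axis a n k c l : (l <= n + k)%N ->
  pattern a n k c (axis l) =
  if l == 0%N then a else if (l <= n)%N then spin_p1 else c.
Proof. by move=> lm; rewrite /pattern axis_in_segment lm axisK. Qed.

Lemma prod_pattern e a n k c :
  \prod_(i <- segment (n + k)) color_factor alpha t e (pattern a n k c i) =
  color_factor alpha t e a * color_weight e n k c.
Proof.
rewrite prod_segment big_nat_recl// pattern_axis//=; congr (_ * _).
rewrite (big_cat_nat (n := n))//= ?leq_addr//; congr (_ * _).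
- rewrite (eq_big_nat _ _ (F2 := fun=> color_factor alpha t e spin_p1)).
    by rewrite prodr_const_nat subn0.
  by move=> l /= ln; rewrite pattern_axis /= ?ln// ltn_addr.
- rewrite (eq_big_nat _ _ (F2 := fun=> color_factor alpha t e c)).
    by rewrite prodr_const_nat addKn.
  by move=> l /andP[nl lm]; rewrite pattern_axis//= ltnNge nl.
Qed.

(** The sign propagates along consecutive occupied sites.  The origin may be
empty, which is why the propagation starts at the next site. *)
Lemma evolved_pattern a n k c : c != spin_0 -> (0 < k)%N ->
  evolved alpha t (segment (n + k)) (pattern a n k c) =
  color_factor alpha t spin_p1 a * color_weight spin_p1 n k c +
  color_factor alpha t spin_m1 a * color_weight spin_m1 n k c.
Proof.
move=> c0 k0; have m0 : (0 < n + k)%N by rewrite ltn_addl.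
have occ l : (0 < l <= n + k)%N -> pattern a n k c (axis l) != spin_0.
  by move=> /andP[l0 lm]; rewrite pattern_axis// gtn_eqF//; case: ifP.
rewrite (evolved_monochromatic alpha_gt0 t_gt0 (i0 :=
  axis 1)) ?axis_in_segment//.
- by rewrite !prod_pattern.
- by rewrite occ.
move=> omega comp occ' i /segmentP[l lm ->] pl.
have step j : (j < n + k)%N -> omega (axis j) != spin_0 ->
    omega (axis j.+1) = omega (axis j).
  move=> jm oj; have oj1 : omega (axis j.+1) != spin_0.
    by rewrite occ' ?axis_in_segment// occ.
  have := comp (axis j) (axis j.+1); rewrite axis_in_segment (ltnW jm).
  move=> /(_ isT (nn_axis j)); move: oj oj1.
  by have [->|->|->] := spin_cases (omega (axis j));
     have [->|->|->] := spin_cases (omega (axis j.+1)).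
have from1 j : (0 < j <= n + k)%N -> omega (axis j) = omega (axis 1).
  elim: j => // -[//|j] IH /andP[_ jm].
  rewrite step// ?IH ?(ltnW jm)//.
  by rewrite occ' ?axis_in_segment ?(ltnW jm)// occ//= ltnW.
case: l lm pl => [|l] lm pl; last by rewrite from1.
by rewrite -(step 0%N)// occ'// axis_in_segment.
Qed.

Lemma pattern_sealed a n k c : sealed (segment (n + k)) (pattern a n k c).
Proof. by move=> i j _ _ jC; rewrite /pattern (negbTE jC). Qed.

Lemma clear_pattern a n k c : clear (segment (n + k))
  (pattern a n k c) = vacuum.
Proof.
by apply/funext => i; rewrite clearE /pattern; case: (i \in segment (n + k)).
Qed.

End segments.

(** * Conditional probabilities that are not quasilocal *)

Section uniform_discrepancy.
Variables (R : realType) (d : nat) (mut : probability (config d) R).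
Implicit Types (L M N D : {fset site d}) (x y : config d) (a : spin)
  (o : site d).

Definition update o a x : config d := fun i => if i == o then a else x i.

Lemma prob_update N o x : o \notin N ->
  prob mut N x = prob mut (o |` N)%fset (update o spin_m1 x) +
    prob mut (o |` N)%fset (update o spin_0 x) +
    prob mut (o |` N)%fset (update o spin_p1 x).
Proof.
move=> oN; apply: EFin_inj; rewrite !EFinD -!probE.
set A := fun a => cylinder (o |` N)%fset (update o a x).
have mA a : measurable (A a) := measurable_cylinder _ _.
have Ao a eta : A a eta -> eta o = a.
  by move=> h; rewrite h ?inE ?eqxx// /update eqxx.
have -> : cylinder N x = (A spin_m1 `|` A spin_0) `|` A spin_p1.
  apply/seteqP; split => [eta h|eta Aeta i iN].
    have Aeta a : eta o = a -> A a eta.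
      move=> e i; rewrite !inE /update => /orP[/eqP->|iN];
        first by rewrite eqxx.
      by rewrite ifN ?h//; apply: contraNneq oN => <-.
    by have [/Aeta|/Aeta|/Aeta] := spin_cases (eta o); [left; left|left;
      right|right].
  have io : i != o by apply: contraNneq oN => <-.
  by case: Aeta => [[]|] h; rewrite h ?inE ?iN ?orbT// /update (negbTE io).
rewrite measureU//; last 2 first.
- exact: measurableU.
- by apply/seteqP; split => // eta [[/Ao e|/Ao e]] /Ao;
  rewrite e => /(congr1 spin_val).
rewrite measureU//.
by apply/seteqP; split => // eta [/Ao e /Ao]; rewrite e => /(congr1 spin_val).
Qed.

Lemma quasilocal_approx (g : config d -> R) (eps : R) : 0 < eps ->
  quasilocal g ->
  exists L, forall w w', (forall i,
    i \in L -> w i = w' i) -> `|g w - g w'| < eps.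
Proof.
move=> eps0 [h hloc hcvg].
have [n _ /(_ n (leqnn n)) /= hn] :=
    hcvg [set f : config d -> R | forall w, `|g w - f w| < eps / 2]
    ((uniform_nbhs _ _).2 (ex_intro _ [set u : R * R | ball u.1 (eps / 2) u.2]
      (conj (entourage_ball _ (PosNum (divr_gt0 eps0 (ltr0Sn R 1))))
        (fun k hk w => hk w I)))).
have [L mh] := hloc n; exists L => w w' ww'.
have -> : g w - g w' = (g w - h n w) - (g w' - h n w').
  by rewrite (measurable_on_eq mh ww'); ring.
by rewrite (le_lt_trans (ler_normB _ _))// [eps]splitr ltrD.
Qed.

(** A quasilocal conditional probability is nearly determined by the
configuration in some finite [L].  It is then nearly constant on each of two
events that look alike in [L], with nearly the same value, and averaging it
over the two events contradicts the gap between [r] and [s]. *)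
Lemma non_Gibbs_of_discrepancy o a (r s : R) : r < s ->
  (forall L, exists N x y,
    [/\ o \notin N, (L `<=` o |` N)%fset,
        (forall i, i \in L -> x i = y i),
        0 < prob mut N x /\ 0 < prob mut N y &
        s * prob mut N x <= prob mut (o |` N)%fset (update o a x) /\
        prob mut (o |` N)%fset (update o a y) <= r * prob mut N y]) ->
  non_Gibbs mut.
Proof.
move=> rs far gamma spec adm ql.
pose Ev : set (config d) := cylinder [fset o]%fset (fun=> a).
have mEv : measurable Ev := measurable_cylinder _ _.
pose g w := fine (gamma [fset o]%fset w Ev).
have gE w : gamma [fset o]%fset w Ev = (g w)%:E.
  by rewrite /g fineK// fin_num_measure.
have [mg dlr] := adm [fset o]%fset Ev mEv.
have g_off w w' : (forall i, i != o -> w i = w' i) -> g w = g w'.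
  move=> e; apply: (@measurable_on_eq _ _ (~` [set` [fset o]%fset])).
    by apply/measurable_EFinP; move: mg; apply: eq_measurable_fun => v _;
      rewrite /= gE.
  by move=> i /= /negP; rewrite inE; exact: e.
have qlg : quasilocal g.
  have -> : g = (fun w => \int[gamma [fset o]%fset w]_v (\1_Ev v : R)).
    by apply/funext => w; rewrite Rintegral_indic.
  apply: ql; exists (fun=> \1_Ev); last first.
    by move=> A /nbhs_singleton EA; exists 0%N => // n _; exact: EA.
  move=> _; exists [fset o]%fset; apply: measurable_indic.
  exact: measurable_cylinder_on.
(* On each event the conditional probability is constant up to [eps], and its
   values on the two events differ by at most [eps]: the ratios [s] and [r] can
   then differ by at most [3 * eps]. *)
pose eps := (s - r) / 8.
have eps0 : 0 < eps by rewrite divr_gt0// subr_gt0.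
have [L gL] := quasilocal_approx eps0 qlg.
have [N [x [y [oN LN xy [px py] [hx hy]]]]] := far L.
(* The spin of [w] at [o] is first replaced by that of [z]: the conditional
   probability does not depend on it. *)
have near w z : cylinder N z w -> `|g w - g z| < eps.
  move=> wz; rewrite (g_off w (update o (z o) w)); last first.
    by move=> i io; rewrite /update (negbTE io).
  apply: gL => i /(fsubsetP LN); rewrite !inE /update.
  by case: eqP => [->//|_ /= iN]; exact: wz.
have joint z : (\int[mut]_(w in cylinder N z) (g w)%:E)%E =
    (prob mut (o |` N)%fset (update o a z))%:E.
  rewrite -probE -[X in mut X](_ : Ev `&` cylinder N z = _).
    rewrite -dlr; last first.
      apply: measurable_cylinder_on => i /= iN; rewrite inE => /eqP io.
      by rewrite -io iN in oN.
    by apply: eq_integral => w _; rewrite gE.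
  apply/seteqP; split => [w [Ew wz] i|w h].
    rewrite !inE /update; have [-> _|_ /= iN] := eqVneq i o; last exact: wz.
    by apply: Ew; rewrite inE.
  split=> i iN.
    by rewrite h ?inE; move: iN; rewrite inE => /eqP->;
      rewrite ?eqxx// /update eqxx.
  rewrite h ?inE ?iN ?orbT// /update ifN//.
  by apply: contraNneq oN => <-.
have mgd : measurable_fun [set: config d] (fun w => (g w)%:E).
  have := @measurable_funW _ _ _ _ mg.
  by apply: eq_measurable_fun => w _; rewrite gE.
have g0 w : 0 <= g w by exact: fine_ge0.
have mz z : measurable (cylinder N z : set (config d)) :=
  measurable_cylinder _ _.
have cst_int z (c : R) : (\int[mut]_(w in cylinder N z) c%:E)%E =
  (c * prob mut N z)%:E.
  by rewrite EFinM -probE integral_cst.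
have ub z : prob mut (o |` N)%fset (update o a z) <= (g z + eps) * prob mut N z.
  rewrite -lee_fin -joint -cst_int; apply: ge0_le_integral; first exact: mz.
  - by move=> w _; rewrite lee_fin.
  - exact: measurable_funS mgd.
  - exact: measurable_cst.
  - move=> w wz; rewrite lee_fin; have := near _ _ wz;
    rewrite ltr_norml => /andP[_].
    lra.
have lb z : (g z - eps) * prob mut N z <= prob mut (o |` N)%fset (update o a z).
  apply: (@le_trans _ _ (Num.max (g z - eps) 0 * prob mut N z)).
    by rewrite ler_wpM2r ?prob_ge0// le_max lexx.
  rewrite -lee_fin -joint -cst_int; apply: ge0_le_integral; first exact: mz.
  - by move=> w _; rewrite lee_fin le_max lexx orbT.
  - exact: measurable_cst.
  - exact: measurable_funS mgd.
  - move=> w wz; rewrite lee_fin ge_max g0 andbT; have := near _ _ wz.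
    by rewrite ltr_norml => /andP[+ _]; lra.
have sx : s <= g x + eps by rewrite -(ler_pM2r px) (le_trans hx).
have ry : g y - eps <= r by rewrite -(ler_pM2r py) (le_trans (lb y)).
have := gL x y xy; rewrite ltr_norml => /andP[_]; rewrite /eps in sx ry *; lra.
Qed.

End uniform_discrepancy.

(** * Discontinuity at the segment and the two regimes *)

Section discontinuity.
Variables (R : realType) (d : nat) (hd : (0 < d)%N).
Variables (alpha : probability spin R) (t : R).
Hypothesis alpha_gt0 : forall a, 0 < mass alpha a.
Hypothesis t_gt0 : 0 < t.
Implicit Types (L M N D : {fset site d}) (x y : config d) (a c e : spin).
Notation activity := (activity alpha).
Notation color_factor := (color_factor alpha t).
Notation color_weight := (color_weight alpha t).

(** Bernoulli's inequality. *)
Lemma pow_dominates (a b c : R) : 0 < b -> b < a -> 0 <= c ->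
  exists k0, forall k, (k0 <= k)%N -> c * b ^+ k <= a ^+ k.
Proof.
move=> b0 ba c0; pose h := a / b - 1.
have h0 : 0 < h by rewrite subr_gt0 ltr_pdivlMr// mul1r.
have bernoulli k : 1 + k%:R * h <= (1 + h) ^+ k.
  elim: k => [|k IH]; first by rewrite mul0r addr0 expr0.
  rewrite exprS; apply: (@le_trans _ _ ((1 + h) * (1 + k%:R * h))).
    by rewrite -natr1; have := ler0n R k; nra.
  by rewrite ler_pM2l// addr_gt0.
exists (Num.bound (c / h)) => k ck.
have ch : c <= (1 + h) ^+ k.
  apply: le_trans (bernoulli k); rewrite -[leLHS](divfK (lt0r_neq0 h0)).
  apply: (@le_trans _ _ (k%:R * h)); last by rewrite lerDr.
  rewrite ler_pM2r//; apply: ltW; apply: lt_le_trans (archi_boundP _) _.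
    by rewrite divr_ge0// ltW.
  by rewrite ler_nat.
have -> : a ^+ k = (1 + h) ^+ k * b ^+ k.
  by rewrite -exprMn /h addrC subrK divfK// gt_eqF.
by rewrite ler_pM2r// exprn_gt0.
Qed.

Lemma color_factorE : [/\ color_factor spin_p1 spin_p1 = activity spin_p1 *
  p_keep t,
  color_factor spin_m1 spin_p1 = activity spin_m1 * p_flip t,
  color_factor spin_p1 spin_m1 = activity spin_p1 * p_flip t &
  color_factor spin_m1 spin_m1 = activity spin_m1 * p_keep t].
Proof. by split; rewrite /color_factor /= flipE. Qed.

Lemma update_pattern a b n k c :
  update (axis hd 0) a (pattern hd b n k c) = pattern hd a n k c.
Proof.
apply/funext => i; rewrite /update; case: eqP => [->|ni].
  by rewrite pattern_axis.
rewrite /pattern; case: ifPn => // /segmentP[l _ il].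
by rewrite il axisK; case: l il => // /ni.
Qed.

Variable mut : probability (config d) R.
Hypothesis prob_factor : forall D M x, nbhd_in D M -> sealed D x ->
  prob mut M x = evolved alpha t D x * prob mut M (clear D x).
Hypothesis prob_vacuum : forall M, 0 < prob mut M vacuum.

Lemma prob_pattern M a n k c : nbhd_in (segment hd (n + k)) M ->
  c != spin_0 -> (0 < k)%N ->
  prob mut M (pattern hd a n k c) =
  (color_factor spin_p1 a * color_weight spin_p1 n k c +
   color_factor spin_m1 a * color_weight spin_m1 n k c) * prob mut M vacuum.
Proof.
move=> nM c0 k0; rewrite (prob_factor nM (@pattern_sealed _ hd a n k c)).
by rewrite clear_pattern evolved_pattern.
Qed.

(** Given the volume [L], take plus on the part of the segment that may meet
[L], then a far end of plus spins ([x]) or of minus spins ([y]) long enough to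
make the posterior weights of the hidden signs at least 2 to 1, respectively at
most 1 to 2. *)
Lemma non_Gibbs_of_bias : mass alpha spin_m1 <= mass alpha spin_p1 ->
  mass alpha spin_p1 * p_flip t < mass alpha spin_m1 * p_keep t ->
  non_Gibbs mut.
Proof.
move=> m_le bias.
set wp := activity spin_p1; set wm := activity spin_m1.
set p := p_keep t; set q := p_flip t.
have m0 := alpha_gt0 spin_0.
have wm0 : 0 < wm := activity_gt0 alpha_gt0 _.
have wp0 : 0 < wp := activity_gt0 alpha_gt0 _.
have wmp : wm <= wp by rewrite ler_pM2r ?invr_gt0.
have q0 : 0 < q := p_flip_gt0 t_gt0.
have qp : q < p := p_flip_lt_keep t.
have p0 : 0 < p := lt_trans q0 qp.
have pq1 : p + q = 1 by rewrite /p /q /p_keep /p_flip; lra.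
have wb : wp * q < wm * p.
  by rewrite /wp /wm /activity mulrAC [ltRHS]mulrAC ltr_pM2r ?invr_gt0.
have [cpp cmp cpm cmm] := color_factorE.
rewrite -/wp -/wm -/p -/q in cpp cmp cpm cmm.
pose U := wp * p; pose V := wm * q; pose S := 1 + wp; pose T := 1 + wm.
have U0 : 0 < U by rewrite mulr_gt0.
have V0 : 0 < V by rewrite mulr_gt0.
have S0 : 0 < S by rewrite addr_gt0.
have T0 : 0 < T by rewrite addr_gt0.
have VU : V < U by rewrite /U /V; nra.
have UTVS : V * S < U * T.
  have h1 : V * wp <= U * wm.
    have -> : V * wp = wp * wm * q by rewrite /V; ring.
    have -> : U * wm = wp * wm * p by rewrite /U; ring.
    by rewrite (ler_pM2l (mulr_gt0 wp0 wm0)) ltW.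
  by rewrite /S /T !mulrDr !mulr1; lra.
(* With posterior weights [X] and [Y] of the hidden plus and minus, the
   probability of a plus at the origin is [(U X + V Y) / (S X + T Y)]; [s] and
   [r] are its values at 2 to 1 and at 1 to 2. *)
pose s := (2 * U + V) / (2 * S + T); pose r := (U + 2 * V) / (S + 2 * T).
have dS : 0 < 2 * S + T by lra.
have dT : 0 < S + 2 * T by lra.
have rs : r < s.
  rewrite /r /s ltr_pdivrMr// mulrAC ltr_pdivlMr//.
  by rewrite -subr_gt0 (_ : _ - _ = 3 * (U * T - V * S)); [lra|ring].
have high X Y : 2 * Y <= X -> s * (S * X + T * Y) <= U * X + V * Y.
  move=> YX; rewrite /s [leLHS]mulrAC ler_pdivrMr// -subr_ge0.
  rewrite (_ : _ - _ = (X - 2 * Y) * (U * T - V * S)); last by ring.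
  by rewrite mulr_ge0// subr_ge0// ltW.
have lowr X Y : 2 * X <= Y -> U * X + V * Y <= r * (S * X + T * Y).
  move=> XY; rewrite /r [leRHS]mulrAC ler_pdivlMr// -subr_ge0.
  rewrite (_ : _ - _ = (Y - 2 * X) * (U * T - V * S)); last by ring.
  by rewrite mulr_ge0// subr_ge0// ltW.
apply: (@non_Gibbs_of_discrepancy _ _ _ (axis hd 0) spin_p1 r s rs) => L.
pose n := (\max_(i <- L) axis_index hd i)%N.
have nL l : axis hd l \in L -> (l <= n)%N.
  by move=> lL; rewrite -[X in (X <= _)%N](axisK hd) leq_bigmax_seq.
have [k1 hk1] := pow_dominates V0 VU (ltW (ltr0Sn R 1)).
(* [C] compensates the pull towards plus of the first [n] sites, which [x] and
   [y] share. *)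
pose C := 2 * U ^+ n / V ^+ n.
have C0 : 0 <= C by rewrite ltW// divr_gt0 ?mulr_gt0 ?exprn_gt0.
have [k2 hk2] := pow_dominates (mulr_gt0 wp0 q0) wb C0.
pose k := (maxn k1 k2).+1.
have k0 : (0 < k)%N by [].
have k1k : (k1 <= n + k)%N.
  by rewrite (leq_trans _ (leq_addl _ _))// /k leqW// leq_maxl.
have k2k : (k2 <= k)%N by rewrite /k leqW// leq_maxr.
have [M' nM'] := nbhd_exists (segment hd (n + k)).
pose M := (M' `|` L)%fset.
have nM : nbhd_in (segment hd (n + k)) M := nbhd_inS nM' (fsubsetUl _ _).
have oM : axis hd 0 \in M.
  by apply: (fsubsetP nM.1); rewrite axis_in_segment.
pose N := (M `\ axis hd 0)%fset.
have oN : axis hd 0 \notin N by rewrite !inE eqxx.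
have MN : (axis hd 0 |` N)%fset = M by exact: fsetD1K.
pose x := pattern hd spin_p1 n k spin_p1;
  pose y := pattern hd spin_p1 n k spin_m1.
have kap := prob_vacuum M.
set kappa := prob mut M vacuum in kap.
have cond c : c != spin_0 ->
    prob mut N (pattern hd spin_p1 n k c) =
    (S * color_weight spin_p1 n k c + T * color_weight spin_m1 n k c) * kappa.
  move=> c0; rewrite (prob_update _ _ oN) MN !update_pattern !prob_pattern//.
  rewrite -/kappa cpp cmp cpm cmm /color_factor eqxx.
  have qE : q = 1 - p by rewrite -pq1 addrC addKr.
  by rewrite /S /T qE; ring.
have joint c : c != spin_0 ->
    prob mut (axis hd 0 |` N)%fset (update (axis hd 0) spin_p1
      (pattern hd spin_p1 n k c)) =
    (U * color_weight spin_p1 n k c + V * color_weight spin_m1 n k c) * kappa.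
  by move=> c0; rewrite MN update_pattern prob_pattern// cpp cmp.
have cw_gt0 e c : e != spin_0 -> c != spin_0 -> 0 < color_weight e n k c.
  have cf_gt0 e' c' : e' != spin_0 -> c' != spin_0 -> 0 < color_factor e' c'.
    move=> e0 c0; rewrite /color_factor (negbTE c0).
    rewrite mulr_gt0 ?activity_gt0// lt_neqAle flip_ge0// andbT eq_sym.
    by rewrite flip_neq0// (negbTE e0) (negbTE c0).
  by move=> e0 c0; rewrite mulr_gt0// exprn_gt0// cf_gt0.
have big_plus : 2 * color_weight spin_m1 n k spin_p1 <= color_weight spin_p1 n
  k spin_p1.
  by rewrite /color_weight cpp cmp -!exprD hk1.
have big_minus : 2 * color_weight spin_p1 n k spin_m1 <= color_weight spin_m1
  n k spin_m1.
  rewrite /color_weight cpp cmp cpm cmm -/U -/V.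
  have := hk2 k k2k; rewrite -(ler_pM2l (exprn_gt0 n V0)); apply: le_trans.
  rewrite /C; set A := U ^+ n; set B := V ^+ n; set D := (_ ^+ k).
  have B0 : B != 0 by rewrite gt_eqF// exprn_gt0.
  by rewrite le_eqVlt; apply/orP; left; apply/eqP; field.
exists N, x, y; split => //.
- by rewrite MN fsubsetUr.
- move=> i iL; rewrite /x /y /pattern; case: ifPn => // /segmentP[l _ il].
  by rewrite il axisK; case: eqP => // _; rewrite nL// -il.
- by rewrite !cond//; split; rewrite mulr_gt0// addr_gt0// mulr_gt0// cw_gt0.
- rewrite !cond// !joint//; split.
  + by rewrite [leLHS]mulrA ler_pM2r// high.
  + by rewrite [leRHS]mulrA ler_pM2r// lowr.
Qed.

End discontinuity.

Lemma evolution_non_Gibbs (R : realType) (d : nat) (hd : (0 < d)%N)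
    (alpha : probability spin R) (alpha_gt0 : forall a, 0 < mass alpha a)
    (t : R) (t_gt0 : 0 < t) (mu mut : probability (config d) R) :
  mass alpha spin_m1 <= mass alpha spin_p1 ->
  mass alpha spin_p1 * p_flip t < mass alpha spin_m1 * p_keep t ->
  clearing_rule alpha mu -> low_intensity mu -> is_time_evolution t mu mut ->
  non_Gibbs mut /\
  exists gamma : kernel_family R d,
    [/\ is_specification gamma,
      admitted gamma mut & mut.-negligible (bad gamma)].
Proof.
move=> m_le bias rule low evol.
have factor D M x : nbhd_in D M -> sealed D x ->
    prob mut M x = evolved alpha t D x * prob mut M (clear D x).
  exact: (prob_evolved_factor t_gt0 evol rule).
have surr : mut (~` [set xi | surrounded xi]) = 0%E.
  by apply: (evolved_surrounded t_gt0 evol); exact: low_intensity_surrounded.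
split.
  apply: (non_Gibbs_of_bias hd alpha_gt0 t_gt0 factor) => // M.
  exact: (prob_evolved_vacuum t_gt0 evol rule).
exists (evolved_specification alpha_gt0 t_gt0); split.
- exact: evolved_specificationP.
- exact: evolved_specification_admitted.
- apply: negligibleS; first exact: bad_not_surrounded.
  by apply/negligibleP => //; apply: measurableC; exact: measurable_surrounded.
Qed.

(** With [b < a] the two masses and [z] the exponential of [2 * t], the bias
reads [z * (a - b) < a + b]. *)
Lemma bias_before_t_G (R : realType) (alpha : probability spin R) (t : R) :
  (forall a, 0 < mass alpha a) -> mass alpha spin_m1 < mass alpha spin_p1 ->
  t < t_G alpha ->
  mass alpha spin_p1 * p_flip t < mass alpha spin_m1 * p_keep t.
Proof.
move=> pos; set a := mass alpha spin_p1; set b := mass alpha spin_m1 => ba.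
have a0 : 0 < a by exact: pos.
have b0 : 0 < b by exact: pos.
rewrite /t_G -/a -/b => tG.
have ab0 : 0 < a - b by rewrite subr_gt0.
have E : expR (2 * t) < (a + b) / (a - b).
  have <- : expR (ln ((a + b) / (a - b))) = (a + b) / (a - b).
    by rewrite lnK// posrE divr_gt0// addr_gt0.
  rewrite ltr_expR.
  by rewrite mulrC -ltr_pdivlMr// mulrC.
rewrite ltr_pdivlMr// in E.
have := expR_gt0 (2 * t); rewrite /p_flip /p_keep expRN.
set z := expR _ in E * => z0.
have zz : z * z^-1 = 1 by rewrite divff// gt_eqF.
have zi0 : 0 < z^-1 by rewrite invr_gt0.
by nra.
Qed.

Theorem theorem2p13 (R : realType) (d : nat) (hd : (0 < d)%N)
    (alpha : probability spin R) (halpha : forall a, 0 < mass alpha a) :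
  (mass alpha spin_m1 < mass alpha spin_p1 ->
   forall mu_plus : probability (config d) R,
     is_plus_measure alpha mu_plus -> low_intensity mu_plus ->
     forall (t : R) (mu_t : probability (config d) R),
       0 < t < t_G alpha -> is_time_evolution t mu_plus mu_t ->
       non_Gibbs mu_t /\
       exists gamma : kernel_family R d,
         [/\ is_specification gamma, admitted gamma mu_t
           & mu_t.-negligible (bad gamma)])
  /\
  (mass alpha spin_m1 = mass alpha spin_p1 ->
   forall mu : probability (config d) R,
     Gibbs_measures (@hc_specification R d alpha) mu ->
     translation_invariant mu -> low_intensity mu ->
     forall (t : R) (mu_t : probability (config d) R),
       0 < t -> is_time_evolution t mu mu_t ->
       non_Gibbs mu_t /\
       exists gamma : kernel_family R d,
         [/\ is_specification gamma, admitted gamma mu_t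
           & mu_t.-negligible (bad gamma)]).
Proof.
split=> [lt_m mu plus low t mut /andP[t0 tG] evol|eq_m mu G _ low t mut t0
  evol].
- apply: (evolution_non_Gibbs hd halpha t0 _ _
  (plus_clearing_rule halpha plus) low evol).
  + exact: ltW.
  + exact: bias_before_t_G.
- apply: (evolution_non_Gibbs hd halpha t0 _ _
  (Gibbs_clearing_rule halpha G) low evol).
  + by rewrite eq_m.
  + by rewrite eq_m ltr_pM2l// p_flip_lt_keep.
Qed.
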